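(* Let $\Omega$, $\beta$, $r=1/\beta$ satisfy the curvature assumption $r<r_0/2$, let $\Phi$ be a polynomial in momenta integral of the magnetic billiard flow in $\Omega$, and let $F:\Omega_r\to\mathbb{R}$ be the function defined by $F\circ\mathcal{L}=\Phi$. Then $F$ is $C^\infty$-smooth on $\overline{\Omega_r}$ (up to the boundary).
   Context: $\Omega\subset\mathbb{R}^2$ is a bounded domain with boundary $\gamma$ a simple closed $C^\infty$ curve parametrized counterclockwise by arc length $s$; $J$ is the counterclockwise rotation by $\pi/2$, $n=J\dot\gamma$, $\gamma_t=\gamma+t\,n$ is the parallel curve, and $r_0$ is the largest radius for which the tubular neighbourhood of $\gamma$ is diffeomorphic to its normal bundle. Magnetic billiard: a particle moves in $\Omega$ with unit speed along arcs of circles of radius $r$ traversed counterclockwise (Larmor arcs), reflected at $\gamma$ by $v\mapsto v-2\langle n,v\rangle n$; $g^t$ is the flow on unit tangent vectors. $\Omega_+$ is the closed annulus bounded by $\gamma$ and $\gamma_{+2r}$ (swept by the Larmor arcs inside $\Omega$ which intersect $\partial\Omega$). A polynomial in momenta integral is $\Phi(x,v)=\sum_{0\le k+l\le N}a_{kl}(x)v_1^kv_2^l$ on unit tangent vectors over $\Omega_+$, $a_{kl}\in C^\infty(\overline{\Omega_+})$, such that (1) $\Phi(g^t(x,v))=\Phi(x,v)$ between collisions for $x\in\gamma$, $v$ inward unit, and (2) $\Phi(x,v)=\Phi(x,v-2\langle n,v\rangle n)$ for $x\in\partial\Omega$. $\Omega_r$ is the annulus bounded by $\gamma_{+r}$ and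 $\gamma_{-r}$; it is the set of centers of circles of radius $r$ intersecting $\gamma$. The map $\mathcal{L}(x,v)=x+rJv$ assigns to a unit vector tangent to a counterclockwise Larmor circle its center. Since $\Phi$ is constant along Larmor arcs, $F$ is well defined on $\Omega_r$ by $F(x+rJv)=\Phi(x,v)$ for unit vectors $(x,v)$ tangent to Larmor arcs inside $\Omega$ intersecting $\partial\Omega$. *)

(* Defs.v *)
From Stdlib Require Import Reals Lra List.
From Coquelicot Require Import Coquelicot.
Open Scope R_scope.

Definition vadd (p q : R * R) : R * R := (fst p + fst q, snd p + snd q).
Definition vsub (p q : R * R) : R * R := (fst p - fst q, snd p - snd q).
Definition vscal (a : R) (p : R * R) : R * R := (a * fst p, a * snd p).
Definition dot (p q : R * R) : R := fst p * fst q + snd p * snd q.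
Definition det2 (p q : R * R) : R := fst p * snd q - snd p * fst q.
Definition Jrot (p : R * R) : R * R := (- snd p, fst p).
Definition rot (th : R) (p : R * R) : R * R :=
  (cos th * fst p - sin th * snd p, sin th * fst p + cos th * snd p).
Definition unit_vec (v : R * R) : Prop := dot v v = 1.

Definition cderiv (c : R -> R * R) (s : R) : R * R :=
  (Derive (fun u => fst (c u)) s, Derive (fun u => snd (c u)) s).

Definition smooth1 (f : R -> R) : Prop :=
  forall (k : nat) (s : R), ex_derive (Derive_n f k) s.

Definition simple_closed_arclength (gamma : R -> R * R) (L : R) : Prop :=
  0 < L /\
  smooth1 (fun u => fst (gamma u)) /\ smooth1 (fun u => snd (gamma u)) /\
  (forall s, gamma (s + L) = gamma s) /\
  (forall s1 s2, 0 <= s1 < L -> 0 <= s2 < L -> gamma s1 = gamma s2 -> s1 = s2) /\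
  (forall s, unit_vec (cderiv gamma s)).

Definition normal (gamma : R -> R * R) (s : R) : R * R := Jrot (cderiv gamma s).

Definition par (gamma : R -> R * R) (t s : R) : R * R :=
  vadd (gamma s) (vscal t (normal gamma s)).

(* The map (s,t) |-> gamma(s) + t n(s) is a diffeomorphism from the normal
   bundle of radius rho (S^1 x (-rho,rho)) onto its image: it is injective and
   has nonvanishing Jacobian determinant det(gamma'(s) + t n'(s), n(s)). *)
Definition tubular_ok (gamma : R -> R * R) (L rho : R) : Prop :=
  0 < rho /\
  (forall s1 s2 t1 t2, 0 <= s1 < L -> 0 <= s2 < L ->
     - rho < t1 < rho -> - rho < t2 < rho ->
     par gamma t1 s1 = par gamma t2 s2 -> s1 = s2 /\ t1 = t2) /\
  (forall s t, - rho < t < rho ->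
     det2 (vadd (cderiv gamma s) (vscal t (cderiv (normal gamma) s)))
          (normal gamma s) <> 0).

(* r_0 is the supremum of the admissible rho (the admissible set is downward
   closed), so  r < r_0 / 2  iff some admissible rho exceeds 2r. *)
Definition curvature_assumption (gamma : R -> R * R) (L r : R) : Prop :=
  exists rho, 2 * r < rho /\ tubular_ok gamma L rho.

Definition bounded_set (S : R * R -> Prop) : Prop :=
  exists M, forall p, S p -> Rabs (fst p) <= M /\ Rabs (snd p) <= M.

Definition open_set (S : R * R -> Prop) : Prop := forall p, S p -> locally p S.

Definition adherent (S : R * R -> Prop) (p : R * R) : Prop :=
  forall e : posreal, exists q, ball p e q /\ S q.

Definition interior_of (S : R * R -> Prop) (p : R * R) : Prop := locally p S.

Definition path_connected (S : R * R -> Prop) : Prop :=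
  forall p q, S p -> S q ->
    exists c : R -> R * R, c 0 = p /\ c 1 = q /\
      forall u, 0 <= u <= 1 -> S (c u) /\ continuous c u.

(* Omega is a bounded domain whose boundary is the curve gamma, and gamma is
   positively (counterclockwise) oriented: n = J gamma' points into Omega. *)
Definition domain_bounded_by (Omega : R * R -> Prop) (gamma : R -> R * R) : Prop :=
  open_set Omega /\ path_connected Omega /\ bounded_set Omega /\
  (exists p, Omega p) /\
  (forall p, (adherent Omega p /\ ~ Omega p) <-> exists s, p = gamma s) /\
  (forall s, exists e, 0 < e /\ forall t, 0 < t < e -> Omega (par gamma t s)).

Definition annulus (gamma : R -> R * R) (a b : R) (p : R * R) : Prop :=
  exists s t, a <= t <= b /\ p = par gamma t s.

Fixpoint pd (w : list bool) (f : R * R -> R) : R * R -> R :=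
  match w with
  | nil => f
  | b :: w' =>
      let g := pd w' f in
      fun p => if b then Derive (fun x => g (x, snd p)) (fst p)
               else Derive (fun y => g (fst p, y)) (snd p)
  end.

Definition smooth_on_open (U : R * R -> Prop) (f : R * R -> R) : Prop :=
  forall (w : list bool) p, U p ->
    continuous (pd w f) p /\
    ex_derive (fun x => pd w f (x, snd p)) (fst p) /\
    ex_derive (fun y => pd w f (fst p, y)) (snd p).

Definition continuous_on (K : R * R -> Prop) (g : R * R -> R) : Prop :=
  forall p, K p -> filterlim g (within K (locally p)) (locally (g p)).

Definition smooth_up_to_boundary (K : R * R -> Prop) (f : R * R -> R) : Prop :=
  continuous_on K f /\
  smooth_on_open (interior_of K) f /\
  forall w : list bool, exists g : R * R -> R,
    continuous_on K g /\ forall p, interior_of K p -> g p = pd w f p.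

(* Larmor motion: starting at (x,v), counterclockwise circle of radius r with
   centre x + r J v; position and velocity at time t. *)
Definition larmor_pos (r : R) (x v : R * R) (t : R) : R * R :=
  vsub (vadd x (vscal r (Jrot v))) (vscal r (Jrot (rot (t / r) v))).
Definition larmor_vel (r : R) (v : R * R) (t : R) : R * R := rot (t / r) v.

Definition reflect (n v : R * R) : R * R := vsub v (vscal (2 * dot n v) n).

Definition poly_momenta (N : nat) (a : nat -> nat -> R * R -> R)
  (x v : R * R) : R :=
  sum_f_R0 (fun k => sum_f_R0 (fun l => a k l x * fst v ^ k * snd v ^ l) (N - k)) N.

Definition poly_integral (Omega : R * R -> Prop) (gamma : R -> R * R) (r : R)
  (N : nat) (a : nat -> nat -> R * R -> R) : Prop :=
  (forall k l, smooth_up_to_boundary (annulus gamma 0 (2 * r)) (a k l)) /\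
  (forall s v t, unit_vec v -> 0 < dot (normal gamma s) v -> 0 <= t ->
     (forall u, 0 < u < t -> Omega (larmor_pos r (gamma s) v u)) ->
     poly_momenta N a (larmor_pos r (gamma s) v t) (larmor_vel r v t)
     = poly_momenta N a (gamma s) v) /\
  (forall s v, unit_vec v ->
     poly_momenta N a (gamma s) v
     = poly_momenta N a (gamma s) (reflect (normal gamma s) v)).

(* Main.v *)
(* Idea.  The circle of radius r centred at c = gamma_t(s), |t| <= r, has
   c + r n(s) = gamma_(t+r)(s) as its point farthest from the curve, and this
   point lies in the closed annulus bounded by gamma and gamma_(+2r).
   Evaluating Phi there, where the velocity is -gamma'(s), gives
     F(c) = sum a_kl(c + r n(s)) (-gamma_1'(s))^k (-gamma_2'(s))^l,
   whose right-hand side is smooth up to the boundary because the foot point s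
   depends smoothly on c in the tube and the a_kl are smooth up to the boundary.
   For |t| < r the formula follows by flowing from the last entrance of the
   circle into Omega to the far point; the entrance is transversal because a
   tangent circle has its centre on gamma_(+-r), and it points inward because
   gamma has exterior balls of radius r.  The curve t = -r is immediate, and
   t = r is reached as a limit of circles through a fixed point of gamma. *)

From Stdlib Require Import Reals Lra Classical ClassicalEpsilon List.
From Coquelicot Require Import Coquelicot.
(* Last, so that [continuous_on] is the one of [Defs], not Coquelicot's. *)
Require Import Defs.
Open Scope R_scope.

(** ** Functions smooth up to the boundary *)

(** [foot] is defined by choice and may jump by periods, so it cannot be differentiated itself.
    Regularity is proved instead for [h (foot gamma p)], for all smooth periodic [h] at once: the
    partial derivatives are again products of such functions with the inverse Jacobian, and an
    induction on the order closes. [Ck] is shaped for that induction: closure under products,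
    inverses and composition is direct, while for words of partial derivatives it is not. The far
    point suits every centre simultaneously because the shift from t to t + r sends [-r, r] onto
    [0, 2r], the range over which the coefficients are smooth; 2 r < rho keeps this range inside the
    tube. That the circle leaves Omega at all requires the outer side of gamma to be disjoint from
    Omega. This is derived from boundedness of Omega, without the Jordan curve theorem. On gamma_r
    the circle is tangent to gamma, and the flow condition, which concerns strictly inward
    velocities, gives nothing there. Since F is not assumed continuous, the limit is taken where F
    is an explicit polynomial in the velocity. *)

(* On the interior, [f] has partial derivatives of order up to [k], all of which
   extend continuously to [K]; mixed partials in every order are included. *)
Fixpoint Ck (K : R * R -> Prop) (k : nat) (f : R * R -> R) : Prop :=
  continuous_on K f /\
  match k with
  | O => True
  | S k' => exists fx fy : R * R -> R,
      (forall p, interior_of K p ->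
         is_derive (fun x => f (x, snd p)) (fst p) (fx p) /\
         is_derive (fun y => f (fst p, y)) (snd p) (fy p)) /\
      Ck K k' fx /\ Ck K k' fy
  end.

Lemma interior_of_subset (K : R * R -> Prop) p : interior_of K p -> K p.
Proof. apply locally_singleton. Qed.

Lemma locally_fst_slice (P : R * R -> Prop) (p : R * R) :
  locally p P -> locally (fst p) (fun x => P (x, snd p)).
Proof.
  intros [e He]; exists e; intros x Hx; apply He; split; simpl;
    [exact Hx | apply ball_center].
Qed.

Lemma locally_snd_slice (P : R * R -> Prop) (p : R * R) :
  locally p P -> locally (snd p) (fun y => P (fst p, y)).
Proof.
  intros [e He]; exists e; intros x Hx; apply He; split; simpl;
    [apply ball_center | exact Hx].
Qed.

Lemma Ck_continuous K k f : Ck K k f -> continuous_on K f.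
Proof. destruct k; intros H; apply H. Qed.

Lemma Ck_pred K k f : Ck K (S k) f -> Ck K k f.
Proof.
  revert f; induction k as [|k IH]; intros f [Hc [fx [fy [Hd [Hx Hy]]]]].
  - split; auto.
  - split; auto. exists fx, fy; auto.
Qed.

Lemma continuous_on_ext (K : R * R -> Prop) f g :
  (forall p, K p -> f p = g p) -> continuous_on K f -> continuous_on K g.
Proof.
  intros E H p Hp. rewrite <- (E p Hp).
  apply filterlim_within_ext with f; auto.
Qed.

Lemma Ck_ext K k f g :
  (forall p, K p -> f p = g p) -> Ck K k f -> Ck K k g.
Proof.
  intros E; destruct k as [|k]; intros [Hc H]; split;
    try (eapply continuous_on_ext; eauto); auto.
  destruct H as [fx [fy [Hd H]]]. exists fx, fy; split; auto.
  intros p Hp; destruct (Hd p Hp); split.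
  - eapply is_derive_ext_loc; eauto.
    apply (locally_fst_slice (fun q => f q = g q)). apply (filter_imp K); auto.
  - eapply is_derive_ext_loc; eauto.
    apply (locally_snd_slice (fun q => f q = g q)). apply (filter_imp K); auto.
Qed.

Lemma continuous_on_of_continuous (K : R * R -> Prop) (f : R * R -> R) :
  (forall p, continuous f p) -> continuous_on K f.
Proof.
  intros H p _. eapply filterlim_filter_le_1; [apply filter_le_within | apply H].
Qed.

Lemma Ck_const K k c : Ck K k (fun _ => c).
Proof.
  revert c; induction k as [|k IH]; intros c; split; auto;
    try (apply continuous_on_of_continuous; intros; apply continuous_const).
  exists (fun _ => 0), (fun _ => 0). split; auto.
  intros p _; split; exact (is_derive_const _ _).
Qed.

Lemma Ck_fst K k : Ck K k (fun p => fst p).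
Proof.
  destruct k; split; auto;
    try (apply continuous_on_of_continuous; intros; apply continuous_fst).
  exists (fun _ => 1), (fun _ => 0). split; [| split; apply Ck_const].
  intros p _; split; [exact (is_derive_id _) | exact (is_derive_const _ _)].
Qed.

Lemma Ck_snd K k : Ck K k (fun p => snd p).
Proof.
  destruct k; split; auto;
    try (apply continuous_on_of_continuous; intros; apply continuous_snd).
  exists (fun _ => 0), (fun _ => 1). split; [| split; apply Ck_const].
  intros p _; split; [exact (is_derive_const _ _) | exact (is_derive_id _)].
Qed.

Lemma continuous_on_plus K f g :
  continuous_on K f -> continuous_on K g -> continuous_on K (fun p => f p + g p).
Proof.
  intros Hf Hg p Hp. eapply filterlim_comp_2; [apply Hf, Hp | apply Hg, Hp |].
  apply (filterlim_plus (K := R_AbsRing) (V := R_NormedModule)).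
Qed.

Lemma continuous_on_mult K f g :
  continuous_on K f -> continuous_on K g -> continuous_on K (fun p => f p * g p).
Proof.
  intros Hf Hg p Hp. eapply filterlim_comp_2; [apply Hf, Hp | apply Hg, Hp |].
  apply (filterlim_mult (K := R_AbsRing)).
Qed.

Lemma continuous_on_inv K f :
  continuous_on K f -> (forall p, K p -> f p <> 0) -> continuous_on K (fun p => / f p).
Proof.
  intros Hf H0 p Hp. eapply filterlim_comp; [apply Hf, Hp |].
  apply (continuous_Rinv (f p)), H0, Hp.
Qed.

Lemma Ck_plus K k f g : Ck K k f -> Ck K k g -> Ck K k (fun p => f p + g p).
Proof.
  revert f g; induction k as [|k IH]; intros f g [Hf Df] [Hg Dg]; split; auto;
    try (apply continuous_on_plus; auto).
  destruct Df as [fx [fy [Df [Hfx Hfy]]]], Dg as [gx [gy [Dg [Hgx Hgy]]]].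
  exists (fun p => fx p + gx p), (fun p => fy p + gy p). split; auto.
  intros p Hp; destruct (Df p Hp), (Dg p Hp);
    split; apply (is_derive_plus (K := R_AbsRing) (V := R_NormedModule)); auto.
Qed.

Lemma Ck_mult K k f g : Ck K k f -> Ck K k g -> Ck K k (fun p => f p * g p).
Proof.
  revert f g; induction k as [|k IH]; intros f g Hf Hg.
  - split; auto. apply continuous_on_mult; [apply Hf | apply Hg].
  - pose proof (Ck_pred _ _ _ Hf) as Pf. pose proof (Ck_pred _ _ _ Hg) as Pg.
    destruct Hf as [Hf [fx [fy [Df [Hfx Hfy]]]]], Hg as [Hg [gx [gy [Dg [Hgx Hgy]]]]].
    split; [apply continuous_on_mult; auto |].
    exists (fun p => fx p * g p + f p * gx p), (fun p => fy p * g p + f p * gy p).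
    split; [| split; apply Ck_plus; auto].
    intros [x y] Hp; destruct (Df _ Hp), (Dg _ Hp); simpl in *; split.
    + apply (is_derive_mult (fun x => f (x, y)) (fun x => g (x, y))); auto.
      exact Rmult_comm.
    + apply (is_derive_mult (fun y => f (x, y)) (fun y => g (x, y))); auto.
      exact Rmult_comm.
Qed.

Lemma Ck_inv K k f : Ck K k f -> (forall p, K p -> f p <> 0) -> Ck K k (fun p => / f p).
Proof.
  intros Hf H0; revert Hf; induction k as [|k IH]; intros Hf.
  - split; auto. apply continuous_on_inv; auto. apply Hf.
  - pose proof (Ck_pred _ _ _ Hf) as Pf.
    destruct Hf as [Hf [fx [fy [Df [Hfx Hfy]]]]].
    split; [apply continuous_on_inv; auto |].
    exists (fun p => -1 * fx p * (/ f p * / f p)), (fun p => -1 * fy p * (/ f p * / f p)).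
    assert (Hi : Ck K k (fun p => / f p * / f p)) by (apply Ck_mult; auto).
    split; [| split; repeat apply Ck_mult; auto using Ck_const].
    intros [x y] Hp; destruct (Df _ Hp); simpl in *.
    pose proof (H0 _ (interior_of_subset _ _ Hp)) as Hn.
    split.
    + replace (-1 * fx (x, y) * (/ f (x, y) * / f (x, y)))
        with (- fx (x, y) / f (x, y) ^ 2) by (field; auto).
      apply (is_derive_inv (fun x => f (x, y))); auto.
    + replace (-1 * fy (x, y) * (/ f (x, y) * / f (x, y)))
        with (- fy (x, y) / f (x, y) ^ 2) by (field; auto).
      apply (is_derive_inv (fun y => f (x, y))); auto.
Qed.

Lemma Ck_pow K k f n : Ck K k f -> Ck K k (fun p => f p ^ n).
Proof.
  intros H; induction n as [|n IH]; simpl; auto using Ck_const, Ck_mult.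
Qed.

Lemma Ck_sum K k (f : nat -> R * R -> R) n :
  (forall i, Ck K k (f i)) -> Ck K k (fun p => sum_f_R0 (fun i => f i p) n).
Proof.
  intros H; induction n as [|n IH]; simpl; auto using Ck_plus.
Qed.

Lemma continuous_on_interior K f p :
  continuous_on K f -> interior_of K p -> continuous f p.
Proof.
  intros Hf Hp P HP. pose proof (Hf p (interior_of_subset _ _ Hp) P HP) as H.
  unfold filtermap, within in *.
  generalize (filter_and _ _ Hp H); apply filter_imp. intros q [H1 H2]; auto.
Qed.

(** Total differentiability of [a] follows from existence of both partial derivatives near the point
    and continuity of one of them, here [ax]. *)
Lemma chain_rule_2d (a ax ay : R * R -> R) (U : R * R -> Prop) (u v : R -> R) t du dv :
  interior_of U (u t, v t) ->
  (forall p, interior_of U p ->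
     is_derive (fun x => a (x, snd p)) (fst p) (ax p) /\
     is_derive (fun y => a (fst p, y)) (snd p) (ay p)) ->
  continuous_on U ax ->
  is_derive u t du -> is_derive v t dv ->
  is_derive (fun s => a (u s, v s)) t (ax (u t, v t) * du + ay (u t, v t) * dv).
Proof.
  intros Hi Hd Hc Hu Hv.
  apply is_derive_Reals. apply is_derive_Reals in Hu. apply is_derive_Reals in Hv.
  apply (derivable_pt_lim_comp_2d (fun x y => a (x, y))); auto.
  apply (filterdiff_differentiable_pt_lim (fun x y => a (x, y))).
  apply (is_derive_filterdiff (fun x y => a (x, y)) (u t) (v t) (fun x y => ax (x, y))).
  - generalize (locally_locally _ _ Hi); apply filter_imp.
    intros [x y] Hp. exact (proj1 (Hd _ Hp)).
  - apply (Hd _ Hi).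
  - apply continuous_ext with ax; [intros []; reflexivity |].
    eapply continuous_on_interior; eauto.
Qed.

Lemma continuous_on_comp (K U : R * R -> Prop) (a q1 q2 : R * R -> R) :
  continuous_on U a -> continuous_on K q1 -> continuous_on K q2 ->
  (forall p, K p -> U (q1 p, q2 p)) ->
  continuous_on K (fun p => a (q1 p, q2 p)).
Proof.
  intros Ha H1 H2 HK p Hp P HP.
  destruct (Ha _ (HK p Hp) P HP) as [e He].
  assert (A1 : locally p (fun q => K q -> ball (q1 p) e (q1 q)))
    by exact (H1 p Hp _ (locally_ball (q1 p) e)).
  assert (A2 : locally p (fun q => K q -> ball (q2 p) e (q2 q)))
    by exact (H2 p Hp _ (locally_ball (q2 p) e)).
  unfold filtermap, within.
  generalize (filter_and _ _ A1 A2). apply filter_imp.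
  intros q [B1 B2] Kq. apply He; [split; simpl; auto | auto].
Qed.

(** The last hypothesis is separate from the one on [K] because partial derivatives of [a] exist
    only in the interior of [U], so the chain rule needs interior points to land there. *)
Lemma Ck_comp K U k (a q1 q2 : R * R -> R) :
  Ck U k a -> Ck K k q1 -> Ck K k q2 ->
  (forall p, K p -> U (q1 p, q2 p)) ->
  (forall p, interior_of K p -> interior_of U (q1 p, q2 p)) ->
  Ck K k (fun p => a (q1 p, q2 p)).
Proof.
  intros Ha H1 H2 HK HI; revert a Ha H1 H2; induction k as [|k IH]; intros a Ha H1 H2;
    pose proof (continuous_on_comp _ _ _ _ _ (Ck_continuous _ _ _ Ha)
      (Ck_continuous _ _ _ H1) (Ck_continuous _ _ _ H2) HK) as Hc.
  - split; auto.
  - pose proof (Ck_pred _ _ _ H1) as P1. pose proof (Ck_pred _ _ _ H2) as P2.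
    split; auto.
    destruct Ha as [_ [ax [ay [Da [Hax Hay]]]]], H1 as [_ [fx [fy [Df [Hfx Hfy]]]]],
      H2 as [_ [gx [gy [Dg [Hgx Hgy]]]]].
    exists (fun p => ax (q1 p, q2 p) * fx p + ay (q1 p, q2 p) * gx p),
           (fun p => ax (q1 p, q2 p) * fy p + ay (q1 p, q2 p) * gy p).
    split; [| split; apply Ck_plus; apply Ck_mult; auto].
    intros [x y] Hp; destruct (Df _ Hp), (Dg _ Hp); simpl in *. split.
    + apply (chain_rule_2d a ax ay U (fun x => q1 (x, y)) (fun x => q2 (x, y))); auto.
      eapply Ck_continuous; eauto.
    + apply (chain_rule_2d a ax ay U (fun y => q1 (x, y)) (fun y => q2 (x, y))); auto.
      eapply Ck_continuous; eauto.
Qed.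

(** At a boundary point [pd w f] depends on values of [f] outside [K]; hence agreement with the
    extension [g] is claimed on the interior only. *)
Lemma pd_Ck K f w k :
  Ck K (k + length w) f ->
  exists g, Ck K k g /\ forall p, interior_of K p -> g p = pd w f p.
Proof.
  revert k; induction w as [|b w IH]; intros k H; simpl in *.
  - rewrite Nat.add_0_r in H. exists f; auto.
  - rewrite Nat.add_succ_r in H. destruct (IH (S k) H) as [g [[_ [gx [gy [Dg [Hx Hy]]]]] E]].
    exists (if b then gx else gy). split; [destruct b; auto |].
    intros p Hp; destruct (Dg p Hp) as [D1 D2]. pose proof (locally_locally _ _ Hp) as Hl.
    destruct b; symmetry; apply is_derive_unique.
    + eapply is_derive_ext_loc; [| exact D1].
      apply (locally_fst_slice (fun q => g q = pd w f q)). revert Hl; apply filter_imp; auto.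
    + eapply is_derive_ext_loc; [| exact D2].
      apply (locally_snd_slice (fun q => g q = pd w f q)). revert Hl; apply filter_imp; auto.
Qed.

Lemma smooth_up_to_boundary_of_Ck K f :
  (forall k, Ck K k f) -> smooth_up_to_boundary K f.
Proof.
  intros H; split; [apply (H O) | split].
  - intros w p Hp. destruct (pd_Ck K f w 1 (H _)) as [g [[Hc [gx [gy [Dg _]]]] E]].
    destruct (Dg p Hp) as [D1 D2]. pose proof (locally_locally _ _ Hp) as Hl.
    assert (He : locally p (fun q => g q = pd w f q)) by (revert Hl; apply filter_imp; auto).
    split; [| split].
    + apply continuous_ext_loc with g; auto. eapply continuous_on_interior; eauto.
    + exists (gx p). eapply is_derive_ext_loc; [| exact D1].
      apply (locally_fst_slice (fun q => g q = pd w f q)); auto.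
    + exists (gy p). eapply is_derive_ext_loc; [| exact D2].
      apply (locally_snd_slice (fun q => g q = pd w f q)); auto.
  - intros w. destruct (pd_Ck K f w 0 (H _)) as [g [[Hc _] E]]. exists g; auto.
Qed.

Lemma Ck_of_smooth_up_to_boundary K f :
  smooth_up_to_boundary K f -> forall k, Ck K k f.
Proof.
  intros [Hc [Hs Hw]].
  (* Generalizing over the word [w] and its extension [g] makes one differentiation pass from [w] to
     [b :: w]; the lemma is the case of the empty word. *)
  assert (G : forall k w g, continuous_on K g ->
            (forall p, interior_of K p -> g p = pd w f p) -> Ck K k g).
  { induction k as [|k IH]; intros w g Hg E; split; auto.
    destruct (Hw (true :: w)) as [gx [Cx Ex]], (Hw (false :: w)) as [gy [Cy Ey]].
    exists gx, gy. split; [| split; eapply IH; eauto].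
    intros p Hp. rewrite (Ex p Hp), (Ey p Hp). destruct (Hs w p Hp) as [_ [D1 D2]].
    pose proof (locally_locally _ _ Hp) as Hl.
    assert (He : locally p (fun q => pd w f q = g q))
      by (revert Hl; apply filter_imp; intros; symmetry; auto).
    split; simpl.
    - eapply is_derive_ext_loc; [| apply Derive_correct, D1].
      apply (locally_fst_slice (fun q => pd w f q = g q)); auto.
    - eapply is_derive_ext_loc; [| apply Derive_correct, D2].
      apply (locally_snd_slice (fun q => pd w f q = g q)); auto. }
  intros k; apply (G k nil f); auto.
Qed.

(** ** Curves and one-variable calculus *)

Definition dist2 (p q : R * R) : R := (fst p - fst q) ^ 2 + (snd p - snd q) ^ 2.

Lemma dist2_segment p q u :
  dist2 (fst p + u * (fst q - fst p), snd p + u * (snd q - snd p)) q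
  = (1 - u) ^ 2 * dist2 p q.
Proof. unfold dist2; simpl; ring. Qed.

Lemma dist2_sym p q : dist2 p q = dist2 q p.
Proof. unfold dist2; ring. Qed.

Lemma dist2_pos p q : 0 <= dist2 p q.
Proof. apply Rplus_le_le_0_compat; apply pow2_ge_0. Qed.

Definition periodic (L : R) (h : R -> R) : Prop := forall s, h (s + L) = h s.

Lemma periodic_IZR L h : periodic L h -> forall k s, h (s + IZR k * L) = h s.
Proof.
  intros H. induction k as [|k IH|k IH] using Z.peano_ind; intros s.
  - f_equal; ring.
  - rewrite succ_IZR. rewrite <- (IH s), <- (H (s + IZR k * L)). f_equal; ring.
  - unfold Z.pred. rewrite plus_IZR.
    rewrite <- (IH s), <- (H (s + (IZR k + -1) * L)). f_equal; ring.
Qed.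

(** Congruence modulo the period is encoded as equality of all periodic functions, which replaces
    the quotient circle throughout. The representative is [s] minus the integer part of [s / L]
    times [L]. *)
Lemma period_representative L s : 0 < L ->
  exists u, 0 <= u < L /\ forall h, periodic L h -> h u = h s.
Proof.
  intros HL. destruct (base_Int_part (s / L)) as [H1 H2].
  exists (s + IZR (- Int_part (s / L)) * L). split.
  - rewrite opp_IZR.
    assert (E : s = s / L * L) by (field; lra).
    split; rewrite E at 1; nra.
  - intros h Hh. apply periodic_IZR; auto.
Qed.

Lemma periodic_Derive L h : periodic L h -> periodic L (Derive h).
Proof.
  intros H s. unfold Derive. f_equal. apply Lim_ext.
  intros u. replace (s + L + u) with ((s + u) + L) by ring.
  rewrite H, H. reflexivity.
Qed.

Lemma smooth1_ex_derive h s : smooth1 h -> ex_derive h s.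
Proof. intros H; apply (H O). Qed.

Lemma smooth1_Derive h : smooth1 h -> smooth1 (Derive h).
Proof.
  intros H k s. apply ex_derive_ext with (Derive_n h (k + 1)).
  - intros t. symmetry. exact (Derive_n_comp h k 1 t).
  - apply H.
Qed.

Lemma smooth1_is_derive h s : smooth1 h -> is_derive h s (Derive h s).
Proof. intros H. apply Derive_correct, smooth1_ex_derive, H. Qed.

Lemma smooth1_continuity_pt h s : smooth1 h -> continuity_pt h s.
Proof.
  intros H. apply continuity_pt_filterlim. apply (ex_derive_continuous h), smooth1_ex_derive, H.
Qed.

Lemma global_min_derive_0 f s l :
  is_derive f s l -> (forall u, f s <= f u) -> l = 0.
Proof.
  intros H Hm. apply is_derive_Reals in H.
  pose (pr := exist _ l H : derivable_pt f s).
  change l with (derive_pt f s pr).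
  apply (deriv_minimum f (s - 1) (s + 1)); auto; lra.
Qed.

Lemma is_derive_shift (f : R -> R) x l :
  is_derive (fun u => f (x + u)) 0 l -> is_derive f x l.
Proof.
  intros H. apply is_derive_Reals in H. apply is_derive_Reals.
  intros eps He. destruct (H eps He) as [d Hd]. exists d. intros u U1 U2.
  specialize (Hd u U1 U2). rewrite Rplus_0_l, Rplus_0_r in Hd. exact Hd.
Qed.

Lemma derivative_estimate f x l eps : is_derive f x l -> 0 < eps ->
  exists delta : posreal, forall y, Rabs (y - x) < delta ->
    Rabs (f y - f x - l * (y - x)) <= eps * Rabs (y - x).
Proof.
  intros [_ H] He. destruct (H x (fun P HP => HP) (mkposreal eps He)) as [d Hd].
  exists d. intros y Hy. specialize (Hd y Hy). simpl in Hd.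
  unfold norm, minus, plus, opp, scal in Hd; simpl in Hd.
  unfold abs, mult in Hd; simpl in Hd.
  replace (f y - f x - l * (y - x)) with (f y + - f x + - ((y + - x) * l)) by ring.
  exact Hd.
Qed.

Lemma continuity_pt_estimate f x eps : continuity_pt f x -> 0 < eps ->
  exists delta : posreal, forall y, Rabs (y - x) < delta -> Rabs (f y - f x) < eps.
Proof.
  intros H He. apply continuity_pt_filterlim in H.
  destruct (proj1 (filterlim_locally f (f x)) H (mkposreal eps He)) as [d Hd].
  exists d. exact Hd.
Qed.

Lemma IVT_near f s w : continuity f -> 0 <= w ->
  f (s - w) * f (s + w) <= 0 -> exists u, Rabs (u - s) <= w /\ f u = 0.
Proof.
  intros Hc Hw Hs. destruct (IVT_gen f (s - w) (s + w) 0 Hc) as [u [Hu E]].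
  - unfold Rmin, Rmax. destruct (Rle_dec (f (s - w)) (f (s + w))); nra.
  - exists u; split; auto. rewrite Rmin_left, Rmax_right in Hu by lra.
    apply Rabs_le; lra.
Qed.

(** * Real induction and exit points of paths *)

Lemma real_interval_induction (P : R -> Prop) b : 0 <= b ->
  P 0 ->
  (forall u, 0 <= u < b -> P u -> exists e, 0 < e /\ forall v, u <= v < u + e -> P v) ->
  (forall u, 0 < u <= b -> (forall v, 0 <= v < u -> P v) -> P u) ->
  P b.
Proof.
  intros Hb H0 Hopen Hclosed.
  (* The supremum [m] of the initial intervals on which [P] holds satisfies [P] by the limit
     hypothesis, and the opening hypothesis would push beyond it if [m < b]. *)
  set (A := fun u => 0 <= u <= b /\ forall v, 0 <= v <= u -> P v).
  assert (A0 : A 0) by (split; [lra |]; intros v Hv; replace v with 0 by lra; auto).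
  destruct (completeness A) as [m [Hub Hlub]].
  - exists b. intros u [Hu _]; lra.
  - exists 0; auto.
  - assert (Hm0 : 0 <= m) by (apply Hub; auto).
    assert (Hmb : m <= b) by (apply Hlub; intros u [Hu _]; lra).
    assert (Hlt : forall v, 0 <= v < m -> P v).
    { intros v Hv. apply NNPP. intros N.
      assert (m <= v); [| lra]. apply Hlub. intros u [Hu1 Hu2].
      apply Rnot_lt_le. intros Hvu. apply N, Hu2. lra. }
    assert (Pm : P m).
    { destruct (Req_dec m 0) as [-> | Nm]; auto. apply Hclosed; auto. lra. }
    destruct (Req_dec m b) as [<- | Nb]; auto.
    exfalso. destruct (Hopen m) as [e [He H]]; auto; [lra |].
    set (v := Rmin b (m + e / 2)).
    assert (m < v) by (unfold v; apply Rmin_glb_lt; lra).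
    assert (v <= m); [| lra].
    apply Hub. split; [split; [lra | apply Rmin_l] |].
    intros w Hw. destruct (Rlt_dec w m); [apply Hlt; lra |].
    apply H. pose proof (Rmin_r b (m + e / 2)). unfold v in *. lra.
Qed.

Lemma continuous_Rplus (f g : R * R -> R) p :
  continuous f p -> continuous g p -> continuous (fun q => f q + g q) p.
Proof. apply (continuous_plus (V := R_NormedModule)). Qed.

Lemma continuous_Rmult (f g : R * R -> R) p :
  continuous f p -> continuous g p -> continuous (fun q => f q * g q) p.
Proof. apply (continuous_mult (K := R_AbsRing)). Qed.

Lemma continuous_Ropp (f : R * R -> R) p :
  continuous f p -> continuous (fun q => - f q) p.
Proof. apply (continuous_opp (V := R_NormedModule)). Qed.

Lemma continuous_of_coords (x y : R -> R) u :
  ex_derive x u -> ex_derive y u -> continuous (fun v => (x v, y v)) u.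
Proof.
  intros Hx Hy P [e He].
  apply ex_derive_continuous in Hx. apply ex_derive_continuous in Hy.
  assert (A : locally u (fun v => ball (x u) e (x v))) by exact (Hx _ (locally_ball _ e)).
  assert (B : locally u (fun v => ball (y u) e (y v))) by exact (Hy _ (locally_ball _ e)).
  generalize (filter_and _ _ A B). unfold filtermap. apply filter_imp.
  intros v [Av Bv]. apply He. split; assumption.
Qed.

(** Real induction on [E (c u)]: openness of [E] gives the forward step, and a failure of the limit
    step is exactly a first exit point. *)
Lemma first_exit (E : R * R -> Prop) (c : R -> R * R) b : 0 <= b ->
  open_set E -> (forall u, continuous c u) -> E (c 0) -> ~ E (c b) ->
  exists u, 0 < u <= b /\ ~ E (c u) /\ adherent E (c u) /\ forall v, 0 <= v < u -> E (c v).
Proof.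
  intros Hb HE Hc H0 Nb. apply NNPP. intros N. apply Nb.
  apply (real_interval_induction (fun u => E (c u)) b); auto.
  - intros u _ Eu. destruct (Hc u E (HE _ Eu)) as [e He].
    exists e. split; [apply cond_pos |]. intros v Hv. apply He.
    change (Rabs (v - u) < e). apply Rabs_def1; lra.
  - intros u Hu Hv. apply NNPP. intros Nu. apply N. exists u.
    split; [exact Hu | split; [exact Nu | split; [| exact Hv]]]. intros e.
    destruct (Hc u _ (locally_ball (c u) e)) as [d Hd]. pose proof (cond_pos d).
    set (v := Rmax 0 (u - d / 2)).
    assert (v < u) by (apply Rmax_lub_lt; lra).
    assert (0 <= v) by apply Rmax_l.
    assert (u - d / 2 <= v) by apply Rmax_r.
    exists (c v). split; [| apply Hv; lra].
    apply Hd. change (Rabs (v - u) < d). apply Rabs_def1; lra.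
Qed.

Lemma path_stays (E : R * R -> Prop) (c : R -> R * R) b : 0 <= b ->
  open_set E -> (forall u, continuous c u) ->
  (forall u, 0 < u <= b -> adherent E (c u) -> E (c u)) ->
  E (c 0) -> E (c b).
Proof.
  intros Hb HE Hc Had H0. apply NNPP. intros N.
  destruct (first_exit E c b Hb HE Hc H0 N) as [u [Hu [Nu [Au _]]]]. auto.
Qed.

(** ** Geometry of the tube, and the flow *)

(* Parameter of a nearest point of the curve, unique only up to the period and
   only inside the tube; hence [foot] is discontinuous, and it is always composed
   with periodic functions below. *)
Definition foot (gamma : R -> R * R) (p : R * R) : R :=
  epsilon (inhabits 0) (fun s => forall u, dist2 p (gamma s) <= dist2 p (gamma u)).

Definition signed_dist (gamma : R -> R * R) (p : R * R) : R :=
  dot (vsub p (gamma (foot gamma p))) (normal gamma (foot gamma p)).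

Definition curve_x (gamma : R -> R * R) (u : R) : R := fst (gamma u).
Definition curve_y (gamma : R -> R * R) (u : R) : R := snd (gamma u).
Definition tangent_x (gamma : R -> R * R) : R -> R := Derive (curve_x gamma).
Definition tangent_y (gamma : R -> R * R) : R -> R := Derive (curve_y gamma).
Definition curvature (gamma : R -> R * R) (s : R) : R :=
  tangent_x gamma s * Derive (tangent_y gamma) s
  - tangent_y gamma s * Derive (tangent_x gamma) s.
(* Its zeros in [s] are the critical points of the distance from [p] to the curve. *)
Definition tangential_offset (gamma : R -> R * R) (p : R * R) (s : R) : R :=
  (fst p - curve_x gamma s) * tangent_x gamma s
  + (snd p - curve_y gamma s) * tangent_y gamma s.

Section Tube.

Variables (gamma : R -> R * R) (L : R).
Hypothesis gamma_curve : simple_closed_arclength gamma L.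

Local Notation g1 := (curve_x gamma).
Local Notation g2 := (curve_y gamma).
Local Notation d1 := (tangent_x gamma).
Local Notation d2 := (tangent_y gamma).
Local Notation kap := (curvature gamma).
Local Notation orth := (tangential_offset gamma).

Lemma curve_length_pos : 0 < L.
Proof. apply gamma_curve. Qed.

Lemma smooth_g1 : smooth1 g1. Proof. apply gamma_curve. Qed.
Lemma smooth_g2 : smooth1 g2. Proof. apply gamma_curve. Qed.

Lemma periodic_g1 : periodic L g1.
Proof. intros s; unfold curve_x; f_equal; apply gamma_curve. Qed.
Lemma periodic_g2 : periodic L g2.
Proof. intros s; unfold curve_y; f_equal; apply gamma_curve. Qed.

Lemma smooth_d1 : smooth1 d1. Proof. apply smooth1_Derive, smooth_g1. Qed.
Lemma smooth_d2 : smooth1 d2. Proof. apply smooth1_Derive, smooth_g2. Qed.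
Lemma periodic_d1 : periodic L d1. Proof. apply periodic_Derive, periodic_g1. Qed.
Lemma periodic_d2 : periodic L d2. Proof. apply periodic_Derive, periodic_g2. Qed.

Lemma unit_tangent s : d1 s * d1 s + d2 s * d2 s = 1.
Proof. apply gamma_curve. Qed.

Lemma par_coords t s : par gamma t s = (g1 s - t * d2 s, g2 s + t * d1 s).
Proof.
  unfold par, vadd, vscal, normal, Jrot, cderiv, curve_x, curve_y; simpl. f_equal.
  unfold tangent_y, curve_y. ring.
Qed.

Lemma same_point_of_periodic s u :
  (forall h, periodic L h -> h s = h u) -> forall t, par gamma t s = par gamma t u.
Proof.
  intros H t. rewrite !par_coords.
  rewrite (H _ periodic_g1), (H _ periodic_g2), (H _ periodic_d1), (H _ periodic_d2). reflexivity.
Qed.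

Lemma par_0 s : par gamma 0 s = gamma s.
Proof.
  rewrite par_coords, (surjective_pairing (gamma s)). unfold curve_x, curve_y. f_equal; ring.
Qed.

Lemma dist2_par t s : dist2 (par gamma t s) (gamma s) = t ^ 2.
Proof.
  rewrite par_coords. unfold dist2, curve_x, curve_y; simpl.
  pose proof (unit_tangent s) as H.
  transitivity (t ^ 2 * (d1 s * d1 s + d2 s * d2 s)); [| rewrite H]; ring.
Qed.

Lemma is_derive_dist2 p s :
  is_derive (fun u => dist2 p (gamma u)) s
    (-2 * ((fst p - g1 s) * d1 s + (snd p - g2 s) * d2 s)).
Proof.
  pose proof (smooth1_is_derive g1 s smooth_g1) as H1.
  pose proof (smooth1_is_derive g2 s smooth_g2) as H2.
  apply is_derive_ext with (fun u => (fst p - g1 u) ^ 2 + (snd p - g2 u) ^ 2);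
    [reflexivity |].
  auto_derive.
  - repeat split; apply smooth1_ex_derive; [apply smooth_g1 | apply smooth_g2].
  - change (Derive (fun x => g1 x) s) with (d1 s).
    change (Derive (fun x => g2 x) s) with (d2 s). ring.
Qed.

Lemma nearest_exists p : exists s, forall u, dist2 p (gamma s) <= dist2 p (gamma u).
Proof.
  destruct (continuity_ab_min (fun u => dist2 p (gamma u)) 0 L) as [s [Hs _]].
  - generalize curve_length_pos; lra.
  - intros c _. apply continuity_pt_filterlim.
    apply (ex_derive_continuous (fun u => dist2 p (gamma u))).
    eexists; apply is_derive_dist2.
  - exists s. intros u. destruct (period_representative L u curve_length_pos) as [v [Hv E]].
    replace (dist2 p (gamma u)) with (dist2 p (gamma v)); [apply Hs; lra |].
    unfold dist2. pose proof (E _ periodic_g1) as E1. pose proof (E _ periodic_g2) as E2.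
    unfold curve_x, curve_y in E1, E2. rewrite E1, E2. reflexivity.
Qed.

Lemma nearest_orthogonal p s :
  (forall u, dist2 p (gamma s) <= dist2 p (gamma u)) ->
  (fst p - g1 s) * d1 s + (snd p - g2 s) * d2 s = 0.
Proof.
  intros H. pose proof (global_min_derive_0 _ _ _ (is_derive_dist2 p s) H). lra.
Qed.

(** Expansion of [p - gamma s] in the orthonormal frame formed by the tangent and the normal; the
    tangential component vanishes. *)
Lemma par_of_orthogonal p s :
  (fst p - g1 s) * d1 s + (snd p - g2 s) * d2 s = 0 ->
  p = par gamma (dot (vsub p (gamma s)) (normal gamma s)) s.
Proof.
  intros H. rewrite par_coords. rewrite (surjective_pairing p) at 1.
  unfold dot, vsub, normal, Jrot, cderiv; simpl.
  fold g1 g2. fold d1 d2. fold (g1 s) (g2 s).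
  pose proof (unit_tangent s) as U.
  set (x := fst p - g1 s) in *. set (y := snd p - g2 s) in *.
  assert (Hx : x = - (x * - d2 s + y * d1 s) * d2 s).
  { transitivity (x * (d1 s * d1 s + d2 s * d2 s) - d1 s * (x * d1 s + y * d2 s));
      [rewrite U, H |]; ring. }
  assert (Hy : y = (x * - d2 s + y * d1 s) * d1 s).
  { transitivity (y * (d1 s * d1 s + d2 s * d2 s) - d2 s * (x * d1 s + y * d2 s));
      [rewrite U, H |]; ring. }
  f_equal; [unfold x in Hx at 1 | unfold y in Hy at 1]; lra.
Qed.

Lemma foot_nearest p u : dist2 p (gamma (foot gamma p)) <= dist2 p (gamma u).
Proof. revert u. unfold foot. apply epsilon_spec, nearest_exists. Qed.

(** Valid in the whole plane, since the displacement from a nearest point is always normal; inside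
    the tube these coordinates are moreover unique. *)
Lemma par_foot p : par gamma (signed_dist gamma p) (foot gamma p) = p.
Proof. symmetry. apply par_of_orthogonal, nearest_orthogonal, foot_nearest. Qed.

Lemma signed_dist_sqr_le p u : signed_dist gamma p ^ 2 <= dist2 p (gamma u).
Proof.
  rewrite <- (dist2_par _ (foot gamma p)), par_foot. apply foot_nearest.
Qed.

(** * Smooth dependence of the foot point inside the tube *)

Variable rho : R.
Hypothesis tube : tubular_ok gamma L rho.

Lemma par_inj s1 s2 t1 t2 :
  - rho < t1 < rho -> - rho < t2 < rho -> par gamma t1 s1 = par gamma t2 s2 ->
  t1 = t2 /\ forall h, periodic L h -> h s1 = h s2.
Proof.
  intros H1 H2 E.
  destruct (period_representative L s1 curve_length_pos) as [u1 [B1 E1]].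
  destruct (period_representative L s2 curve_length_pos) as [u2 [B2 E2]].
  rewrite <- (same_point_of_periodic _ _ E1), <- (same_point_of_periodic _ _ E2) in E.
  destruct tube as [_ [Hinj _]]. destruct (Hinj _ _ _ _ B1 B2 H1 H2 E) as [Eu Et].
  split; auto. intros h Hh. rewrite <- (E1 h Hh), <- (E2 h Hh), Eu. reflexivity.
Qed.

(** The point [gamma s] is at distance |t|, so the nearest one is no farther and its normal
    coordinate also lies in (-rho, rho); injectivity then identifies both pairs of coordinates. *)
Lemma signed_dist_par t s : - rho < t < rho ->
  signed_dist gamma (par gamma t s) = t /\
  forall h, periodic L h -> h (foot gamma (par gamma t s)) = h s.
Proof.
  intros Ht. apply par_inj; auto; [| apply par_foot].
  pose proof (signed_dist_sqr_le (par gamma t s) s) as H. rewrite dist2_par in H.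
  split; nra.
Qed.

(** The determinant in [tubular_ok] expands to |gamma'|^2 - t det(gamma', gamma''), that is 1 - t
    times the signed curvature. *)
Lemma jacobian_neq_0 s t : - rho < t < rho -> 1 - t * kap s <> 0.
Proof.
  intros Ht E. destruct tube as [_ [_ HJ]]. apply (HJ s t Ht).
  unfold det2, vadd, vscal, cderiv, normal, Jrot, cderiv; simpl.
  fold g1 g2; fold d1 d2.
  rewrite Derive_opp. change (Derive (fun x => d2 x)) with (Derive d2).
  change (Derive (fun x => d1 x)) with (Derive d1).
  pose proof (unit_tangent s). unfold curvature in E. nra.
Qed.

Lemma is_derive_orth t s : is_derive (orth (par gamma t s)) s (- (1 - t * kap s)).
Proof.
  pose proof (smooth1_is_derive g1 s smooth_g1) as H1.
  pose proof (smooth1_is_derive g2 s smooth_g2) as H2.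
  unfold tangential_offset. rewrite par_coords. simpl.
  auto_derive.
  - repeat split; apply smooth1_ex_derive;
      auto using smooth_g1, smooth_g2, smooth_d1, smooth_d2.
  - change (Derive (fun x => g1 x) s) with (d1 s).
    change (Derive (fun x => g2 x) s) with (d2 s).
    change (Derive (fun x => d1 x) s) with (Derive d1 s).
    change (Derive (fun x => d2 x) s) with (Derive d2 s).
    pose proof (unit_tangent s) as U. unfold curvature.
    transitivity (- (d1 s * d1 s + d2 s * d2 s)
      + t * (d1 s * Derive d2 s - d2 s * Derive d1 s)); [| rewrite U]; ring.
Qed.

Lemma orth_par t s : orth (par gamma t s) s = 0.
Proof. unfold tangential_offset. rewrite par_coords; simpl. ring. Qed.

Lemma continuity_orth p : continuity (orth p).
Proof.
  intros s. unfold tangential_offset.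
  assert (smooth1_continuity := smooth1_continuity_pt).
  apply continuity_pt_plus; apply continuity_pt_mult;
    auto using smooth_d1, smooth_d2;
    apply continuity_pt_minus; auto using smooth_g1, smooth_g2;
    apply continuity_pt_const; intros ? ?; reflexivity.
Qed.

Lemma tangent_le_1 s : Rabs (d1 s) <= 1 /\ Rabs (d2 s) <= 1.
Proof.
  pose proof (unit_tangent s). split; apply Rabs_le; split; nra.
Qed.

Lemma orth_shift p q s :
  Rabs (orth p s - orth q s) <= Rabs (fst p - fst q) + Rabs (snd p - snd q).
Proof.
  unfold tangential_offset. destruct (tangent_le_1 s) as [B1 B2].
  replace (_ - _) with ((fst p - fst q) * d1 s + (snd p - snd q) * d2 s) by ring.
  eapply Rle_trans; [apply Rabs_triang |]. rewrite !Rabs_mult.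
  pose proof (Rabs_pos (fst p - fst q)). pose proof (Rabs_pos (snd p - snd q)). nra.
Qed.

(* A one-dimensional implicit function theorem: the intermediate value theorem
   for the tangential offset on an interval proportional to the displacement. *)
Lemma foot_local t0 s0 : - rho < t0 < rho ->
  exists (C : R) (delta : posreal), 0 < C /\ forall p,
    Rabs (fst p - fst (par gamma t0 s0)) + Rabs (snd p - snd (par gamma t0 s0)) < delta ->
    exists s,
      Rabs (s - s0) <= C * (Rabs (fst p - fst (par gamma t0 s0))
                          + Rabs (snd p - snd (par gamma t0 s0))) /\
      orth p s = 0 /\ forall h, periodic L h -> h (foot gamma p) = h s.
Proof.
  intros Ht. pose proof (jacobian_neq_0 s0 t0 Ht) as HJ.
  set (D := 1 - t0 * kap s0) in *.
  set (p0 := par gamma t0 s0).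
  assert (HD : 0 < Rabs D) by (apply Rabs_pos_lt; auto).
  destruct (derivative_estimate _ _ _ (Rabs D / 2) (is_derive_orth t0 s0))
    as [eta Heta]; [lra |].
  fold p0 in Heta.
  (* The intermediate value theorem yields only a critical point [s] of the distance. Injectivity of
     the tube identifies it with the foot once its normal coordinate is known to lie in (-rho, rho);
     [T] serves to control that coordinate. *)
  set (T := fun s => dot (vsub p0 (gamma s)) (normal gamma s)).
  assert (HT0 : T s0 = t0).
  { unfold T, p0. rewrite par_coords. unfold dot, vsub, normal, Jrot, cderiv; simpl.
    fold g1 g2; fold d1 d2. fold (g1 s0) (g2 s0). pose proof (unit_tangent s0) as U.
    transitivity (t0 * (d1 s0 * d1 s0 + d2 s0 * d2 s0)); [| rewrite U]; ring. }
  assert (HTc : continuity_pt T s0).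
  { change (continuity_pt (fun s => (fst p0 - g1 s) * - d2 s + (snd p0 - g2 s) * d1 s) s0).
    assert (smooth1_continuity := smooth1_continuity_pt).
    apply continuity_pt_plus; apply continuity_pt_mult;
    auto using smooth_d1, smooth_d2;
    try (apply continuity_pt_opp; auto using smooth_d2);
    apply continuity_pt_minus; auto using smooth_g1, smooth_g2;
    apply continuity_pt_const; intros ? ?; reflexivity. }
  (* Half of the room between |t0| and rho: one half is for moving [s0] to [s], the other for moving
     [p0] to [p]. *)
  set (gap := (rho - Rabs t0) / 2).
  assert (Hgap : 0 < gap).
  { unfold gap. assert (Rabs t0 < rho) by (apply Rabs_def1; lra). lra. }
  destruct (continuity_pt_estimate _ _ _ HTc Hgap) as [eta2 Heta2].
  assert (HC : 0 < 4 / Rabs D) by (apply Rdiv_lt_0_compat; lra).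
  assert (Hdel : 0 < Rmin gap (Rmin eta eta2 * Rabs D / 4)).
  { apply Rmin_pos; auto. apply Rdiv_lt_0_compat; [| lra].
    apply Rmult_lt_0_compat; auto. apply Rmin_pos; apply cond_pos. }
  exists (4 / Rabs D), (mkposreal _ Hdel). split; auto.
  intros p Hp. simpl in Hp.
  set (e := Rabs (fst p - fst p0) + Rabs (snd p - snd p0)) in *.
  assert (He0 : 0 <= e) by (unfold e; pose proof (Rabs_pos (fst p - fst p0));
    pose proof (Rabs_pos (snd p - snd p0)); lra).
  assert (He1 : e < gap) by (eapply Rlt_le_trans; [exact Hp | apply Rmin_l]).
  assert (He2 : 4 / Rabs D * e < Rmin eta eta2).
  { assert (e < Rmin eta eta2 * Rabs D / 4) by (eapply Rlt_le_trans; [exact Hp | apply Rmin_r]).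
    replace (Rmin eta eta2) with (4 / Rabs D * (Rmin eta eta2 * Rabs D / 4)) by (field; lra).
    apply Rmult_lt_compat_l; auto. }
  (* At [s0 - w] and [s0 + w] the offset of [p0] has size at least |D| w / 2 = 2 e, with opposite
     signs. Replacing [p0] by [p] changes it by at most [e], so the signs survive. *)
  set (w := 4 / Rabs D * e) in *.
  assert (Hw0 : 0 <= w) by (unfold w; apply Rmult_le_pos; lra).
  assert (Hw1 : w < eta) by (eapply Rlt_le_trans; [exact He2 | apply Rmin_l]).
  assert (Hw2 : w < eta2) by (eapply Rlt_le_trans; [exact He2 | apply Rmin_r]).
  assert (Ew : 2 * e = Rabs D / 2 * w) by (unfold w; field; lra).
  destruct (IVT_near (orth p) s0 w (continuity_orth p) Hw0) as [s [Hs1 Hs2]].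
  { pose proof (orth_shift p p0 (s0 - w)) as A1. pose proof (orth_shift p p0 (s0 + w)) as A2.
    fold e in A1, A2.
    assert (B1 : Rabs (s0 - w - s0) = w) by (rewrite <- (Rabs_pos_eq w Hw0) at 2; rewrite <- Rabs_Ropp; f_equal; ring).
    assert (B2 : Rabs (s0 + w - s0) = w) by (rewrite <- (Rabs_pos_eq w Hw0) at 2; f_equal; ring).
    pose proof (Heta (s0 - w)) as C1. pose proof (Heta (s0 + w)) as C2.
    rewrite B1 in C1. rewrite B2 in C2. specialize (C1 Hw1). specialize (C2 Hw1).
    unfold p0 in C1, C2. rewrite orth_par in C1, C2. fold p0 D in C1, C2.
    apply Rabs_le_between in A1. apply Rabs_le_between in A2.
    apply Rabs_le_between in C1. apply Rabs_le_between in C2.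
    unfold Rabs in Ew, C1, C2; destruct (Rcase_abs D).
    - assert (orth p (s0 - w) <= 0) by nra. assert (0 <= orth p (s0 + w)) by nra. nra.
    - assert (0 <= orth p (s0 - w)) by nra. assert (orth p (s0 + w) <= 0) by nra. nra. }
  exists s. split; [exact Hs1 | split; [exact Hs2 |]].
  pose proof (par_of_orthogonal p s Hs2) as Ep.
  set (t := dot (vsub p (gamma s)) (normal gamma s)) in Ep.
  rewrite Ep. apply signed_dist_par.
  assert (HTs : Rabs (T s - t0) < gap).
  { rewrite <- HT0. apply (Heta2 s).
    eapply Rle_lt_trans; [exact Hs1 | exact Hw2]. }
  assert (Htt : Rabs (t - T s) <= e).
  { change (t - T s) with (((fst p - g1 s) * - d2 s + (snd p - g2 s) * d1 s)
      - ((fst p0 - g1 s) * - d2 s + (snd p0 - g2 s) * d1 s)).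
    destruct (tangent_le_1 s) as [B1 B2]. unfold e.
    match goal with |- Rabs ?X <= _ =>
      replace X with ((fst p - fst p0) * - d2 s + (snd p - snd p0) * d1 s) by ring end.
    eapply Rle_trans; [apply Rabs_triang |]. rewrite !Rabs_mult, Rabs_Ropp.
    pose proof (Rabs_pos (fst p - fst p0)). pose proof (Rabs_pos (snd p - snd p0)). nra. }
  assert (Hsum : Rabs t < rho).
  { replace t with ((t - T s) + (T s - t0) + t0) by ring.
    eapply Rle_lt_trans; [apply Rabs_triang |].
    pose proof (Rabs_triang (t - T s) (T s - t0)). unfold gap in *. lra. }
  apply Rabs_lt_between in Hsum. exact Hsum.
Qed.

Lemma continuous_foot h p :
  periodic L h -> smooth1 h -> - rho < signed_dist gamma p < rho ->
  continuous (fun q => h (foot gamma q)) p.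
Proof.
  intros Hp Hh Ht. destruct (foot_local _ (foot gamma p) Ht) as [C [delta [HC H]]].
  rewrite par_foot in H.
  pose proof (smooth1_continuity_pt h (foot gamma p) Hh) as Hc.
  apply filterlim_locally. intros eps.
  destruct (continuity_pt_estimate _ _ _ Hc (cond_pos eps)) as [eta Heta].
  assert (Hr : 0 < Rmin (delta / 2) (eta / (2 * C))).
  { pose proof (cond_pos delta). pose proof (cond_pos eta).
    apply Rmin_pos; apply Rdiv_lt_0_compat; lra. }
  exists (mkposreal _ Hr). intros [x y] [Q1 Q2].
  change (Rabs (x - fst p) < Rmin (delta / 2) (eta / (2 * C))) in Q1.
  change (Rabs (y - snd p) < Rmin (delta / 2) (eta / (2 * C))) in Q2.
  pose proof (Rmin_l (delta / 2) (eta / (2 * C))).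
  pose proof (Rmin_r (delta / 2) (eta / (2 * C))).
  destruct (H (x, y)) as [s [Hs [_ E]]]; simpl in *; [lra |].
  rewrite (E h Hp). apply Heta.
  change (Rabs (s - foot gamma p) < eta). eapply Rle_lt_trans; [exact Hs |].
  replace (pos eta) with (C * (2 * (eta / (2 * C)))) by (field; lra).
  apply Rmult_lt_compat_l; lra.
Qed.

(** Implicit differentiation of [orth] = 0 along the line p + x (e1, e2): the offset grows at rate e
    . gamma' in x and at rate -(1 - t kappa) in s. *)
Lemma is_derive_foot h p e1 e2 :
  periodic L h -> smooth1 h -> - rho < signed_dist gamma p < rho ->
  Rabs e1 <= 1 -> Rabs e2 <= 1 ->
  is_derive (fun x => h (foot gamma (fst p + x * e1, snd p + x * e2))) 0
    (Derive h (foot gamma p) * (e1 * d1 (foot gamma p) + e2 * d2 (foot gamma p))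
       / (1 - signed_dist gamma p * kap (foot gamma p))).
Proof.
  intros Hp Hh Ht He1 He2.
  set (s0 := foot gamma p). set (t0 := signed_dist gamma p) in *.
  assert (Ep : par gamma t0 s0 = p) by apply par_foot.
  destruct (foot_local t0 s0 Ht) as [C [delta [HC H]]]. rewrite Ep in H.
  set (c := fun x : R => (fst p + x * e1, snd p + x * e2)).
  assert (Hcx : forall x, Rabs (fst (c x) - fst p) + Rabs (snd (c x) - snd p) <= 2 * Rabs x).
  { intros x. unfold c; simpl.
    replace (fst p + x * e1 - fst p) with (x * e1) by ring.
    replace (snd p + x * e2 - snd p) with (x * e2) by ring.
    rewrite !Rabs_mult. pose proof (Rabs_pos x). nra. }
  (* A branch close to [s0] replaces [foot], whose value may differ by a period; [h] does not see
     the difference. The Lipschitz bound at 0 is what makes the branch differentiable there. *)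
  assert (Hsig : exists sig : R -> R, forall x, Rabs x < delta / 2 ->
    Rabs (sig x - s0) <= 2 * C * Rabs x /\ orth (c x) (sig x) = 0 /\
    h (foot gamma (c x)) = h (sig x)).
  { exists (fun x => epsilon (inhabits 0) (fun s =>
      Rabs (s - s0) <= 2 * C * Rabs x /\ orth (c x) s = 0 /\ h (foot gamma (c x)) = h s)).
    intros x Hx. apply epsilon_spec.
    destruct (H (c x)) as [s [S1 [S2 S3]]]; [specialize (Hcx x); lra |].
    exists s. repeat split; auto.
    eapply Rle_trans; [exact S1 |]. specialize (Hcx x). nra. }
  destruct Hsig as [sig Hsig].
  pose proof (cond_pos delta) as Hdel.
  assert (Hs0 : sig 0 = s0).
  { destruct (Hsig 0) as [A _]; [rewrite Rabs_R0; lra |].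
    rewrite Rabs_R0, Rmult_0_r in A. apply Rminus_diag_uniq.
    apply NNPP. intros N. apply Rabs_no_R0 in N. pose proof (Rabs_pos (sig 0 - s0)). lra. }
  pose proof (jacobian_neq_0 s0 t0 Ht) as HJ.
  set (D := 1 - t0 * kap s0) in *.
  set (E := fun s => e1 * d1 s + e2 * d2 s).
  assert (Dsig : is_derive sig 0 (E s0 / D)).
  { apply is_derive_Reals. intros eps Heps.
    assert (HD : 0 < Rabs D) by (apply Rabs_pos_lt; auto).
    (* The error is [eps1] times 2 C |x| from linearizing the offset in [s], plus [eps1] times |x|
       from the continuity of [E]; the choice makes the sum eps |D| |x| / 2. *)
    set (eps1 := eps * Rabs D / (2 * (2 * C + 1))).
    assert (Heps1 : 0 < eps1).
    { unfold eps1. apply Rdiv_lt_0_compat; [apply Rmult_lt_0_compat; lra | lra]. }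
    destruct (derivative_estimate _ _ _ eps1 (is_derive_orth t0 s0) Heps1) as [eta1 Heta1].
    rewrite orth_par, Ep in Heta1. fold D in Heta1.
    assert (Ec : continuity_pt E s0).
    { apply continuity_pt_plus; apply continuity_pt_mult;
        try (apply continuity_pt_const; intros ? ?; reflexivity);
        apply smooth1_continuity_pt; auto using smooth_d1, smooth_d2. }
    destruct (continuity_pt_estimate _ _ _ Ec Heps1) as [eta2 Heta2].
    assert (Hr : 0 < Rmin (delta / 2) (Rmin eta1 eta2 / (2 * C))).
    { apply Rmin_pos; [lra |]. apply Rdiv_lt_0_compat; [| lra].
      apply Rmin_pos; apply cond_pos. }
    exists (mkposreal _ Hr). intros x Hx0 Hx. simpl in Hx. rewrite Rplus_0_l, Hs0.
    assert (X1 : Rabs x < delta / 2) by (eapply Rlt_le_trans; [exact Hx | apply Rmin_l]).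
    assert (X2 : 2 * C * Rabs x < Rmin eta1 eta2).
    { replace (Rmin eta1 eta2) with (2 * C * (Rmin eta1 eta2 / (2 * C))) by (field; lra).
      apply Rmult_lt_compat_l; [lra |]. eapply Rlt_le_trans; [exact Hx | apply Rmin_r]. }
    destruct (Hsig x X1) as [S1 [S2 _]].
    assert (Y1 : Rabs (sig x - s0) < eta1) by
      (eapply Rle_lt_trans; [exact S1 |]; eapply Rlt_le_trans; [exact X2 | apply Rmin_l]).
    assert (Y2 : Rabs (sig x - s0) < eta2) by
      (eapply Rle_lt_trans; [exact S1 |]; eapply Rlt_le_trans; [exact X2 | apply Rmin_r]).
    specialize (Heta1 _ Y1). specialize (Heta2 _ Y2).
    (* For fixed [s], [orth (c x) s] is affine in [x] with slope [E s], and it vanishes at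
       [s = sig x]. *)
    assert (Eq : orth p (sig x) = - x * E (sig x)).
    { transitivity (orth (c x) (sig x) - x * E (sig x)); [| rewrite S2; ring].
      unfold tangential_offset, c, E; simpl; ring. }
    rewrite Eq in Heta1.
    assert (Bd : Rabs (D * (sig x - s0) - x * E s0) <= eps1 * (2 * C + 1) * Rabs x).
    { replace (D * (sig x - s0) - x * E s0) with
        ((- x * E (sig x) - 0 - - D * (sig x - s0)) + x * (E (sig x) - E s0)) by ring.
      eapply Rle_trans; [apply Rabs_triang |]. rewrite (Rabs_mult x).
      pose proof (Rabs_pos x). pose proof (Rabs_pos (sig x - s0)). nra. }
    pose proof (Rabs_pos_lt x Hx0) as Hxp.
    replace ((sig x - s0) / x - E s0 / D) with ((D * (sig x - s0) - x * E s0) / (x * D))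
      by (field; auto).
    unfold Rdiv. rewrite Rabs_mult, Rabs_inv, Rabs_mult.
    apply Rmult_lt_reg_r with (Rabs x * Rabs D); [apply Rmult_lt_0_compat; auto |].
    rewrite Rmult_assoc, Rinv_l by (apply Rgt_not_eq, Rmult_lt_0_compat; auto).
    rewrite Rmult_1_r. eapply Rle_lt_trans; [exact Bd |].
    replace (eps1 * (2 * C + 1)) with (eps * Rabs D / 2) by (unfold eps1; field; lra).
    assert (0 < eps * Rabs D * Rabs x) by (repeat apply Rmult_lt_0_compat; auto). nra. }
  apply is_derive_ext_loc with (fun x => h (sig x)).
  - assert (Hd2 : 0 < delta / 2) by lra. exists (mkposreal _ Hd2). intros x Hx.
    symmetry. apply Hsig. change (Rabs (x - 0) < delta / 2) in Hx.
    rewrite Rminus_0_r in Hx. exact Hx.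
  - replace (Derive h s0 * (e1 * d1 s0 + e2 * d2 s0) / D) with (scal (E s0 / D) (Derive h s0)).
    + apply (is_derive_comp h sig); auto. rewrite Hs0. apply smooth1_is_derive; auto.
    + unfold scal; simpl; unfold mult; simpl. unfold E. field; auto.
Qed.

(** Relative to a hypothesis at order [k], so that it can be used inside the induction that proves
    this hypothesis. *)
Lemma Ck_signed_dist K k :
  (forall h, periodic L h -> smooth1 h -> Ck K k (fun p => h (foot gamma p))) ->
  Ck K k (signed_dist gamma).
Proof.
  intros H.
  apply Ck_ext with (fun p => (fst p + -1 * g1 (foot gamma p)) * (-1 * d2 (foot gamma p))
                            + (snd p + -1 * g2 (foot gamma p)) * d1 (foot gamma p)).
  - intros p _. unfold signed_dist, dot, vsub, normal, Jrot, cderiv; simpl.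
    unfold curve_x, curve_y, tangent_x, tangent_y. unfold curve_x, curve_y. ring.
  - repeat (apply Ck_plus || apply Ck_mult);
      auto using Ck_const, Ck_fst, Ck_snd, periodic_g1, periodic_g2, periodic_d1,
        periodic_d2, smooth_g1, smooth_g2, smooth_d1, smooth_d2.
Qed.

Lemma Ck_foot (K : R * R -> Prop) k h :
  (forall p, K p -> - rho < signed_dist gamma p < rho) ->
  periodic L h -> smooth1 h -> Ck K k (fun p => h (foot gamma p)).
Proof.
  intros HK. revert h; induction k as [|k IH]; intros h Hp Hh;
    assert (Hc : continuous_on K (fun p => h (foot gamma p))).
  1, 3: intros p Kp; eapply filterlim_filter_le_1;
    [apply filter_le_within | apply continuous_foot; auto].
  - split; auto.
  - split; auto.
    (* The Jacobian at the foot, written with [+] and [-1 *] to match the closure lemmas for [Ck].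
       It involves only periodic functions of the foot and the signed distance, so it has order [k]
       by induction. *)
    set (J := fun p => 1 + -1 * (signed_dist gamma p * kap (foot gamma p))).
    assert (HJ : Ck K k (fun p => / J p)).
    { apply Ck_inv.
      - unfold J. apply Ck_plus; [apply Ck_const |]. apply Ck_mult; [apply Ck_const |].
        apply Ck_mult; [apply Ck_signed_dist; auto |].
        apply Ck_ext with (fun p => d1 (foot gamma p) * Derive d2 (foot gamma p)
           + -1 * (d2 (foot gamma p) * Derive d1 (foot gamma p))).
        { intros p _; unfold curvature; ring. }
        repeat (apply Ck_plus || apply Ck_mult);
          auto using Ck_const, periodic_d1, periodic_d2, smooth_d1, smooth_d2,
            periodic_Derive, smooth1_Derive.
      - intros p Kp. unfold J.
        pose proof (jacobian_neq_0 (foot gamma p) _ (HK p Kp)). lra. }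
    exists (fun p => Derive h (foot gamma p) * d1 (foot gamma p) * / J p),
           (fun p => Derive h (foot gamma p) * d2 (foot gamma p) * / J p).
    split; [| split; repeat apply Ck_mult;
      auto using periodic_d1, periodic_d2, smooth_d1, smooth_d2,
            periodic_Derive, smooth1_Derive].
    intros p Ip. pose proof (HK p (interior_of_subset _ _ Ip)) as Ht.
    assert (Jn : J p = 1 - signed_dist gamma p * kap (foot gamma p)) by (unfold J; ring).
    rewrite Jn. clear HJ.
    assert (N0 : Rabs 0 <= 1) by (rewrite Rabs_R0; lra).
    assert (N1 : Rabs 1 <= 1) by (rewrite Rabs_R1; lra).
    split.
    + pose proof (is_derive_foot h p 1 0 Hp Hh Ht N1 N0) as D.
      apply is_derive_shift. match type of D with is_derive _ _ ?l => replace (_ * _) with l end.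
      * revert D; apply is_derive_ext. intros x; simpl. do 3 f_equal; ring.
      * unfold Rdiv; ring.
    + pose proof (is_derive_foot h p 0 1 Hp Hh Ht N0 N1) as D.
      apply is_derive_shift. match type of D with is_derive _ _ ?l => replace (_ * _) with l end.
      * revert D; apply is_derive_ext. intros x; simpl. do 3 f_equal; ring.
      * unfold Rdiv; ring.
Qed.

Lemma continuous_signed_dist p :
  - rho < signed_dist gamma p < rho -> continuous (signed_dist gamma) p.
Proof.
  intros Ht. pose proof continuous_foot as C.
  apply (continuous_Rplus
    (fun p => (fst p - g1 (foot gamma p)) * - d2 (foot gamma p))
    (fun p => (snd p - g2 (foot gamma p)) * d1 (foot gamma p)));
    apply continuous_Rmult.
  - apply continuous_Rplus; [apply continuous_fst | apply continuous_Ropp].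
    apply (C g1); auto using periodic_g1, smooth_g1.
  - apply continuous_Ropp, (C d2); auto using periodic_d2, smooth_d2.
  - apply continuous_Rplus; [apply continuous_snd | apply continuous_Ropp].
    apply (C g2); auto using periodic_g2, smooth_g2.
  - apply (C d1); auto using periodic_d1, smooth_d1.
Qed.

(** * Annuli in tube coordinates *)

Lemma annulus_iff a b p : - rho < a -> b < rho ->
  annulus gamma a b p <-> a <= signed_dist gamma p <= b.
Proof.
  intros Ha Hb; split.
  - intros [s [t [Ht ->]]]. destruct (signed_dist_par t s) as [E _]; lra.
  - intros H. exists (foot gamma p), (signed_dist gamma p).
    split; auto. symmetry; apply par_foot.
Qed.

Lemma par_near t s (e : posreal) t' : Rabs (t' - t) < e -> ball (par gamma t s) e (par gamma t' s).
Proof.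
  intros H. rewrite !par_coords. destruct (tangent_le_1 s) as [B1 B2].
  pose proof (Rabs_pos (t' - t)). split; simpl.
  - change (Rabs ((g1 s - t' * d2 s) - (g1 s - t * d2 s)) < e).
    replace (_ - _ - _) with (- ((t' - t) * d2 s)) by ring.
    rewrite Rabs_Ropp, Rabs_mult. nra.
  - change (Rabs ((g2 s + t' * d1 s) - (g2 s + t * d1 s)) < e).
    replace (_ + _ - _) with ((t' - t) * d1 s) by ring.
    rewrite Rabs_mult. nra.
Qed.

Lemma signed_dist_near_interval a b p : - rho <= a -> b <= rho ->
  a < signed_dist gamma p < b -> locally p (fun q => a < signed_dist gamma q < b).
Proof.
  intros Ha Hb H.
  assert (C : continuous (signed_dist gamma) p) by (apply continuous_signed_dist; lra).
  apply (C (fun x => a < x < b)). apply (open_and (fun x => a < x) (fun x => x < b)); auto;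
    [apply open_gt | apply open_lt].
Qed.

Lemma interior_annulus_iff a b p : - rho < a -> b < rho ->
  interior_of (annulus gamma a b) p <-> a < signed_dist gamma p < b.
Proof.
  intros Ha Hb; split.
  - intros [e He].
    assert (K : forall t, Rabs (t - signed_dist gamma p) < e -> annulus gamma a b (par gamma t (foot gamma p))).
    { intros t Ht. apply He. rewrite <- (par_foot p) at 1. apply par_near; auto. }
    set (t := signed_dist gamma p) in *.
    assert (H0 : a <= t <= b).
    { apply annulus_iff; auto. rewrite <- (par_foot p). apply K. fold t.
      rewrite Rminus_diag, Rabs_R0. apply cond_pos. }
    pose proof (cond_pos e).
    split; apply Rnot_le_lt; intros N.
    (* Here the coordinate would equal [a]. A normal step [u] leaves the annulus; it is below [e] to
       remain in the ball and below [a + rho] to remain in the tube. *)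
    + set (u := Rmin (e / 2) ((a + rho) / 2)).
      assert (U : 0 < u) by (apply Rmin_pos; lra).
      assert (U1 : u <= e / 2) by apply Rmin_l.
      assert (U2 : u <= (a + rho) / 2) by apply Rmin_r.
      assert (A : annulus gamma a b (par gamma (t - u) (foot gamma p))).
      { apply K. apply Rabs_def1; lra. }
      apply annulus_iff in A; auto.
      destruct (signed_dist_par (t - u) (foot gamma p)) as [E _]; lra.
    + set (u := Rmin (e / 2) ((rho - b) / 2)).
      assert (U : 0 < u) by (apply Rmin_pos; lra).
      assert (U1 : u <= e / 2) by apply Rmin_l.
      assert (U2 : u <= (rho - b) / 2) by apply Rmin_r.
      assert (A : annulus gamma a b (par gamma (t + u) (foot gamma p))).
      { apply K. apply Rabs_def1; lra. }
      apply annulus_iff in A; auto.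
      destruct (signed_dist_par (t + u) (foot gamma p)) as [E _]; lra.
  - intros H. unfold interior_of. apply (filter_imp (fun q => a < signed_dist gamma q < b)).
    + intros q Hq. apply annulus_iff; lra.
    + apply signed_dist_near_interval; lra.
Qed.

(** * The two sides of the curve *)

Variable Omega : R * R -> Prop.
Hypothesis domain : domain_bounded_by Omega gamma.

Lemma adherent_boundary p : adherent Omega p -> ~ Omega p -> exists s, p = gamma s.
Proof. intros A N. apply domain. auto. Qed.

Lemma adherent_curve s : adherent Omega (gamma s).
Proof. apply (proj2 (proj1 (proj2 (proj2 (proj2 (proj2 domain)))) (gamma s))). eauto. Qed.

Lemma path_avoiding_curve (c : R -> R * R) b : 0 <= b ->
  (forall u, continuous c u) -> (forall u s, 0 < u <= b -> c u <> gamma s) ->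
  Omega (c 0) -> Omega (c b).
Proof.
  intros Hb Hc Hn H0. apply path_stays; auto.
  - apply domain.
  - intros u Hu A. apply NNPP. intros N.
    destruct (adherent_boundary _ A N) as [s Es]. exact (Hn u s Hu Es).
Qed.

Lemma par_not_on_curve t s u : - rho < t < rho -> t <> 0 -> par gamma t s <> gamma u.
Proof.
  intros Ht N E. rewrite <- (par_0 u) in E.
  destruct tube as [Hr _]. destruct (par_inj _ _ _ _ Ht (conj (Ropp_lt_gt_0_contravar _ Hr) Hr) E).
  auto.
Qed.

(** Interpolating both coordinates linearly keeps t nonzero and of constant sign, so by injectivity
    the path never meets gamma and cannot leave Omega. *)
Lemma par_path_in_domain s0 t0 s1 t1 :
  Omega (par gamma t0 s0) -> 0 < t0 * t1 -> - rho < t0 < rho -> - rho < t1 < rho ->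
  Omega (par gamma t1 s1).
Proof.
  intros H0 Hs Ht0 Ht1.
  set (t := fun u => t0 + u * (t1 - t0)). set (s := fun u => s0 + u * (s1 - s0)).
  replace t1 with (t 1) by (unfold t; ring). replace s1 with (s 1) by (unfold s; ring).
  assert (HtC : forall u, ex_derive t u) by (intros; unfold t; auto_derive; auto).
  assert (HsC : forall u, ex_derive s u) by (intros; unfold s; auto_derive; auto).
  assert (HtR : forall u, 0 <= u <= 1 -> - rho < t u < rho /\ t u <> 0).
  { intros u Hu. unfold t. split; [destruct (Rle_dec t0 t1); split; nra |].
    destruct (Rtotal_order t0 0) as [N | [N | N]].
    - assert (t1 < 0) by nra. apply Rlt_not_eq. destruct (Rle_dec t0 t1); nra.
    - subst; lra.
    - assert (0 < t1) by nra. apply Rgt_not_eq. destruct (Rle_dec t0 t1); nra. }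
  apply (path_avoiding_curve (fun u => par gamma (t u) (s u))); [lra | | |].
  - intros u. apply continuous_ext with
      (fun v => (g1 (s v) - t v * d2 (s v), g2 (s v) + t v * d1 (s v))).
    { intros v. symmetry. apply par_coords. }
    assert (Hcomp : forall h, smooth1 h -> ex_derive (fun v => h (s v)) u).
    { intros h Hh. apply ex_derive_comp; auto. apply smooth1_ex_derive; auto. }
    apply continuous_of_coords.
    + apply (ex_derive_minus (V := R_NormedModule)); [auto using smooth_g1 |].
      apply ex_derive_mult; auto using smooth_d2.
    + apply (ex_derive_plus (V := R_NormedModule)); [auto using smooth_g2 |].
      apply ex_derive_mult; auto using smooth_d1.
  - intros u v Hu. destruct (HtR u); [lra |]. apply par_not_on_curve; auto.
  - unfold t, s. rewrite !Rmult_0_l, !Rplus_0_r. exact H0.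
Qed.

Lemma inner_par_in_domain t s : 0 < t < rho -> Omega (par gamma t s).
Proof.
  intros Ht.
  destruct (proj2 (proj2 (proj2 (proj2 (proj2 domain)))) s) as [e [He H]].
  set (u := Rmin (e / 2) t).
  assert (U : 0 < u) by (apply Rmin_pos; lra).
  assert (U1 : u <= e / 2) by apply Rmin_l.
  assert (U2 : u <= t) by apply Rmin_r.
  apply (par_path_in_domain s u); [apply H; lra | nra | lra | lra].
Qed.

(* Otherwise the closure of Omega would also be open, hence the whole plane. *)
Lemma outer_par_not_in_domain t s : - rho < t < 0 -> ~ Omega (par gamma t s).
Proof.
  intros Ht H. destruct tube as [Hrho _].
  assert (Hall : forall t' s', - rho < t' < rho ->
    Omega (par gamma t' s') \/ exists u, par gamma t' s' = gamma u).
  { intros t' s' Ht'. destruct (Rtotal_order t' 0) as [N | [-> | N]].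
    - left. apply (par_path_in_domain s t); auto; nra.
    - right. exists s'. apply par_0.
    - left. apply inner_par_in_domain; lra. }
  set (E := fun p => Omega p \/ exists u, p = gamma u).
  assert (EE : forall p, - rho < signed_dist gamma p < rho -> E p).
  { intros p Hp. rewrite <- (par_foot p). apply Hall, Hp. }
  assert (Eopen : open_set E).
  { intros p [Hp | [u ->]].
    - eapply filter_imp; [| apply (proj1 domain), Hp]. intros q Hq; left; exact Hq.
    - eapply filter_imp; [exact EE |]. apply signed_dist_near_interval; try lra.
      rewrite <- (par_0 u). destruct (signed_dist_par 0 u) as [-> _]; lra. }
  assert (Eadh : forall p, adherent E p -> E p).
  { intros p Hp. destruct (classic (Omega p)) as [| N]; [left; auto | right].
    apply adherent_boundary; auto. intros e.
    assert (He : 0 < e / 2) by (pose proof (cond_pos e); lra).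
    destruct (Hp (mkposreal _ He)) as [q [Bq [Oq | [u ->]]]].
    - exists q. split; auto. apply ball_le with (e / 2); auto. simpl. lra.
    - destruct (adherent_curve u (mkposreal _ He)) as [q [Bq' Oq]].
      exists q. split; auto. replace (pos e) with (e / 2 + e / 2) by field.
      eapply ball_triangle; [exact Bq | exact Bq']. }
  destruct (proj1 (proj2 (proj2 domain))) as [M HM].
  (* Every point within distance 1 of this one has first coordinate above M + 1, which contradicts
     the bound on Omega. *)
  assert (HE : E (M + 2, 0)).
  { set (c := fun u => (fst (par gamma t s) + u * (M + 2 - fst (par gamma t s)),
                        snd (par gamma t s) + u * (0 - snd (par gamma t s)))).
    replace (M + 2, 0) with (c 1) by (unfold c; f_equal; ring).
    apply path_stays; auto; [lra | |].
    - intros u. apply continuous_of_coords; auto_derive; auto.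
    - left. unfold c. rewrite !Rmult_0_l, !Rplus_0_r, <- surjective_pairing. exact H. }
  assert (Hadh : adherent Omega (M + 2, 0)).
  { destruct HE as [HO | [u ->]]; [| apply adherent_curve].
    intros e; exists (M + 2, 0); split; auto. apply ball_center. }
  destruct (Hadh (mkposreal 1 Rlt_0_1)) as [[x y] [[B _] Oq]].
  destruct (HM _ Oq) as [HMx _]. simpl in HMx.
  change (Rabs (x - (M + 2)) < 1) in B.
  apply Rabs_def2 in B. apply Rabs_le_between in HMx. lra.
Qed.

(** The centre is at distance exactly sigma from gamma, so the segment from [p] to it misses gamma;
    if [p] were in Omega, so would be the centre. *)
Lemma exterior_ball sigma s p : 0 < sigma < rho ->
  dist2 p (par gamma (- sigma) s) < sigma ^ 2 -> ~ Omega p.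
Proof.
  intros Hs Hd HO.
  set (q := par gamma (- sigma) s) in *.
  apply (outer_par_not_in_domain (- sigma) s); [lra |]. fold q.
  set (c := fun u => (fst p + u * (fst q - fst p), snd p + u * (snd q - snd p))).
  replace q with (c 1)
    by (rewrite (surjective_pairing q); unfold c; f_equal; ring).
  apply path_avoiding_curve; [lra | | |].
  - intros u. apply continuous_of_coords; auto_derive; auto.
  - intros u v Hu Ev. pose proof (signed_dist_sqr_le q v) as H.
    unfold q at 1 in H. destruct (signed_dist_par (- sigma) s) as [E _]; [lra |].
    rewrite E, <- Ev, dist2_sym in H. unfold c in H. rewrite dist2_segment in H.
    pose proof (dist2_pos p q) as P. assert (Hu' : (1 - u) ^ 2 <= 1) by nra.
    pose proof (Rmult_le_compat_r _ _ _ P Hu'). nra.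
  - unfold c. rewrite !Rmult_0_l, !Rplus_0_r, <- surjective_pairing. exact HO.
Qed.

(** * Larmor circles near the curve *)

Variable r : R.
Hypothesis r_pos : 0 < r.
Hypothesis r_small : 2 * r < rho.

(** With an outward velocity the orbit would at once enter the exterior ball of radius r touching
    gamma at [gamma s]. The tangential case is left open here and is excluded through the position
    of the centre. *)
Lemma larmor_enters_inward s v eps : unit_vec v -> 0 < eps ->
  (forall u, 0 < u < eps -> Omega (larmor_pos r (gamma s) v u)) ->
  0 <= dot (normal gamma s) v.
Proof.
  intros Hv He H. apply Rnot_lt_le. intros Ha.
  set (al := dot (normal gamma s) v) in *.
  (* Multiplied by 2 r^2, this function bounds from above the squared distance to
     [par gamma (- r) s] minus r^2; the factor 2 absorbs the cosine [ka <= 1] of the angle between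
     the two radii. *)
  assert (D : is_derive (fun th => al * sin th + 2 * (1 - cos th)) 0 al).
  { auto_derive; auto. rewrite sin_0, cos_0. ring. }
  destruct (derivative_estimate _ _ _ (- al / 2) D) as [d Hd]; [lra |].
  pose proof (cond_pos d) as Hdp.
  set (th := Rmin (d / 2) (eps / r / 2)).
  assert (He' : 0 < eps / r) by (apply Rdiv_lt_0_compat; auto).
  assert (T0 : 0 < th) by (apply Rmin_pos; lra).
  assert (T1 : th <= d / 2) by apply Rmin_l.
  assert (T2 : th <= eps / r / 2) by apply Rmin_r.
  assert (Neg : al * sin th + 2 * (1 - cos th) < 0).
  { specialize (Hd th). rewrite Rminus_0_r, (Rabs_pos_eq th), sin_0, cos_0 in Hd by lra.
    specialize (Hd ltac:(lra)). apply Rabs_le_between in Hd. nra. }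
  assert (Hu : 0 < r * th < eps).
  { split; [nra |]. replace eps with (r * (eps / r)) by (field; lra).
    apply Rmult_lt_compat_l; lra. }
  refine (exterior_ball r s _ _ _ (H (r * th) Hu)); [lra |].
  unfold larmor_pos. replace (r * th / r) with th by (field; lra).
  rewrite par_coords. unfold dist2, vsub, vadd, vscal, Jrot, rot; simpl.
  change (fst (gamma s)) with (g1 s). change (snd (gamma s)) with (g2 s).
  unfold unit_vec, dot in Hv.
  assert (Eal : al = - d2 s * fst v + d1 s * snd v) by reflexivity.
  clearbody al. pose proof (unit_tangent s) as U.
  pose proof (sin2_cos2 th) as SC. unfold Rsqr in SC. pose proof (COS_bound th) as CB.
  destruct v as [v1 v2]; simpl in *.
  set (a1 := d1 s) in *. set (a2 := d2 s) in *. set (S := sin th) in *. set (C := cos th) in *.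
  set (ka := a2 * v2 + a1 * v1).
  assert (Hka : ka <= 1).
  { unfold ka. pose proof (pow2_ge_0 (a1 - v1)). pose proof (pow2_ge_0 (a2 - v2)). nra. }
  match goal with |- ?X < _ => replace X with
    (r ^ 2 * ((v1 * v1 + v2 * v2) * (S * S + C * C - 2 * C + 1)
       + (a1 * a1 + a2 * a2) + 2 * (S * al + (1 - C) * ka))) by (subst al; unfold ka; ring) end.
  rewrite Hv, U, SC.
  assert (B : (1 - C) * ka <= (1 - C) * 1) by (apply Rmult_le_compat_l; lra).
  assert (Hr2 : 0 < r ^ 2) by (apply pow_lt, r_pos).
  apply Rlt_0_minus.
  match goal with |- 0 < ?X => replace X with
    (r ^ 2 * - (2 * (1 - C) + 2 * (S * al + (1 - C) * ka))) by ring end.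
  apply Rmult_lt_0_compat; lra.
Qed.

(* The circle is traversed clockwise (backwards in time), starting from the point
   farthest from the curve. *)
Definition larmor_circle (t s phi : R) : R * R :=
  (fst (par gamma t s) + r * (sin phi * d1 s - cos phi * d2 s),
   snd (par gamma t s) + r * (sin phi * d2 s + cos phi * d1 s)).

(** The velocity of the counterclockwise motion, hence opposite to the [phi]-derivative of
    [larmor_circle]. *)
Definition larmor_direction (s phi : R) : R * R :=
  (- (cos phi * d1 s + sin phi * d2 s), sin phi * d1 s - cos phi * d2 s).

Lemma rot_larmor_direction s phi th :
  rot th (larmor_direction s phi) = larmor_direction s (phi - th).
Proof.
  unfold rot, larmor_direction; simpl. rewrite cos_minus, sin_minus. f_equal; ring.
Qed.

Lemma unit_larmor_direction s phi : unit_vec (larmor_direction s phi).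
Proof.
  unfold unit_vec, dot, larmor_direction; simpl. pose proof (unit_tangent s) as U.
  pose proof (sin2_cos2 phi) as SC. unfold Rsqr in SC.
  match goal with |- ?X = _ => replace X with
    ((sin phi * sin phi + cos phi * cos phi) * (d1 s * d1 s + d2 s * d2 s)) by ring end.
  rewrite U, SC; ring.
Qed.

Lemma larmor_circle_center t s phi :
  vadd (larmor_circle t s phi) (vscal r (Jrot (larmor_direction s phi))) = par gamma t s.
Proof.
  rewrite (surjective_pairing (par gamma t s)).
  unfold vadd, vscal, Jrot, larmor_circle, larmor_direction; simpl. f_equal; ring.
Qed.

Lemma larmor_pos_circle t s phi u :
  larmor_pos r (larmor_circle t s phi) (larmor_direction s phi) u
  = larmor_circle t s (phi - u / r).
Proof.
  unfold larmor_pos. rewrite larmor_circle_center, rot_larmor_direction.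
  unfold vsub, vscal, Jrot, larmor_circle, larmor_direction; simpl. f_equal; ring.
Qed.

Lemma larmor_circle_0 t s : larmor_circle t s 0 = par gamma (t + r) s.
Proof.
  unfold larmor_circle. rewrite !par_coords, sin_0, cos_0; simpl. f_equal; ring.
Qed.

Lemma larmor_circle_PI t s : larmor_circle t s PI = par gamma (t - r) s.
Proof.
  unfold larmor_circle. rewrite !par_coords, sin_PI, cos_PI; simpl. f_equal; ring.
Qed.

Lemma continuous_larmor_circle t s phi : continuous (larmor_circle t s) phi.
Proof. apply continuous_of_coords; auto_derive; auto. Qed.

Lemma tangent_of_normal_dot_0 s v : unit_vec v -> dot (normal gamma s) v = 0 ->
  exists e, Rabs e = 1 /\ v = (e * d1 s, e * d2 s).
Proof.
  intros Hv H. change (- d2 s * fst v + d1 s * snd v = 0) in H.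
  unfold unit_vec, dot in Hv. pose proof (unit_tangent s) as U.
  destruct v as [v1 v2]; simpl in *.
  set (a1 := d1 s) in *. set (a2 := d2 s) in *.
  exists (a1 * v1 + a2 * v2).
  assert (E1 : v1 = (a1 * v1 + a2 * v2) * a1).
  { transitivity (v1 * (a1 * a1 + a2 * a2) + a2 * (- a2 * v1 + a1 * v2)); [rewrite U, H |]; ring. }
  assert (E2 : v2 = (a1 * v1 + a2 * v2) * a2).
  { transitivity (v2 * (a1 * a1 + a2 * a2) - a1 * (- a2 * v1 + a1 * v2)); [rewrite U, H |]; ring. }
  split; [| f_equal; auto].
  assert (Q : (a1 * v1 + a2 * v2) * (a1 * v1 + a2 * v2) = 1).
  { transitivity ((v1 * v1 + v2 * v2) * (a1 * a1 + a2 * a2)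
      - (- a2 * v1 + a1 * v2) * (- a2 * v1 + a1 * v2)); [| rewrite U, H, Hv]; ring. }
  rewrite <- sqrt_Rsqr_abs. unfold Rsqr. rewrite Q. apply sqrt_1.
Qed.

Lemma center_of_tangent_circle s v : unit_vec v -> dot (normal gamma s) v = 0 ->
  exists e, Rabs e = 1 /\ vadd (gamma s) (vscal r (Jrot v)) = par gamma (e * r) s.
Proof.
  intros Hv H. destruct (tangent_of_normal_dot_0 s v Hv H) as [e [He ->]].
  exists e; split; auto. rewrite par_coords.
  unfold vadd, vscal, Jrot; simpl. fold (g1 s) (g2 s). f_equal; ring.
Qed.

(** * The function of the centre and its formula at the far point *)

Variables (N : nat) (a : nat -> nat -> R * R -> R).
Hypothesis integral : poly_integral Omega gamma r N a.
Variable F : R * R -> R.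
Hypothesis F_integral : forall s v, unit_vec v ->
  F (vadd (gamma s) (vscal r (Jrot v))) = poly_momenta N a (gamma s) v.

Lemma F_open_annulus t s : - r < t < r ->
  F (par gamma t s) = poly_momenta N a (par gamma (t + r) s) (- d1 s, - d2 s).
Proof.
  intros Ht.
  destruct (first_exit Omega (larmor_circle t s) PI) as [phi [Hphi [Nphi [Aphi Hin]]]].
  - generalize PI_RGT_0; lra.
  - apply domain.
  - apply continuous_larmor_circle.
  - rewrite larmor_circle_0. apply inner_par_in_domain; lra.
  - rewrite larmor_circle_PI. apply outer_par_not_in_domain; lra.
  - destruct (adherent_boundary _ Aphi Nphi) as [s1 E1].
    set (v := larmor_direction s phi).
    assert (Hv : unit_vec v) by apply unit_larmor_direction.
    assert (Hpos : forall u, larmor_pos r (gamma s1) v u = larmor_circle t s (phi - u / r))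
      by (intros u; rewrite <- E1; apply larmor_pos_circle).
    assert (Hc : vadd (gamma s1) (vscal r (Jrot v)) = par gamma t s)
      by (rewrite <- E1; apply larmor_circle_center).
    (* In forward time the arc from the entrance to the far point lasts r phi, while the parameter
       decreases from [phi] to 0. *)
    assert (Hom : forall u, 0 < u < r * phi -> Omega (larmor_pos r (gamma s1) v u)).
    { intros u Hu. rewrite Hpos. apply Hin.
      assert (0 < u / r) by (apply Rdiv_lt_0_compat; lra).
      assert (u / r < phi).
      { apply Rmult_lt_reg_l with r; auto. replace (r * (u / r)) with u by (field; lra). lra. }
      lra. }
    assert (Hrp : 0 < r * phi) by nra.
    pose proof (larmor_enters_inward s1 v (r * phi) Hv Hrp Hom) as Hn.
    assert (Hn' : 0 < dot (normal gamma s1) v).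
    { destruct Hn as [Hn | Hn]; auto. exfalso.
      destruct (center_of_tangent_circle s1 v Hv (eq_sym Hn)) as [e [He Ee]].
      rewrite Hc in Ee.
      assert (Her : e = 1 \/ e = -1) by (unfold Rabs in He; destruct (Rcase_abs e); lra).
      destruct (par_inj s s1 t (e * r)) as [Et _]; auto; destruct Her; subst; lra. }
    destruct integral as [_ [Hflow _]].
    rewrite <- Hc, F_integral by auto.
    rewrite <- (Hflow s1 v (r * phi) Hv Hn') by (auto; lra).
    rewrite Hpos. unfold larmor_vel, v. rewrite rot_larmor_direction.
    replace (phi - r * phi / r) with 0 by (field; lra).
    rewrite larmor_circle_0. f_equal.
    unfold larmor_direction. rewrite sin_0, cos_0. f_equal; ring.
Qed.

(** The centre is at distance r from [gamma s]. If its signed distance were r, [gamma s] would be a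
    nearest point and the radius would be normal there, forcing sin th = 0. *)
Lemma signed_dist_inward_center s th : 0 < th < PI ->
  let c := vadd (gamma s) (vscal r (Jrot (rot th (cderiv gamma s)))) in
  - r <= signed_dist gamma c < r.
Proof.
  intros Hth c.
  assert (Sp : 0 < sin th) by (apply sin_gt_0; lra).
  set (v := rot th (cderiv gamma s)) in *.
  assert (Ev : v = (cos th * d1 s - sin th * d2 s, sin th * d1 s + cos th * d2 s)) by reflexivity.
  pose proof (unit_tangent s) as U. pose proof (sin2_cos2 th) as SC. unfold Rsqr in SC.
  assert (Hd : dist2 c (gamma s) = r ^ 2).
  { unfold c, dist2, vadd, vscal, Jrot. rewrite Ev. simpl.
    match goal with |- ?X = _ => replace X with
      (r ^ 2 * ((sin th * sin th + cos th * cos th) * (d1 s * d1 s + d2 s * d2 s))) by ring end.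
    rewrite U, SC; ring. }
  pose proof (signed_dist_sqr_le c s) as H. rewrite Hd in H.
  assert (Hle : - r <= signed_dist gamma c <= r) by (split; nra).
  split; [lra |]. apply Rnot_le_lt. intros Hr.
  assert (Er : signed_dist gamma c = r) by lra.
  assert (Hmin : forall u, dist2 c (gamma s) <= dist2 c (gamma u)).
  { intros u. rewrite Hd, <- Er. apply signed_dist_sqr_le. }
  apply nearest_orthogonal in Hmin.
  unfold c, vadd, vscal, Jrot in Hmin. rewrite Ev in Hmin. simpl in Hmin.
  fold (g1 s) (g2 s) in Hmin.
  assert (r * sin th * (d1 s * d1 s + d2 s * d2 s) = 0) by lra.
  rewrite U in H0. nra.
Qed.

Lemma Ck_poly_momenta K k q1 q2 v1 v2 :
  (forall i j, Ck K k (fun p => a i j (q1 p, q2 p))) -> Ck K k v1 -> Ck K k v2 ->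
  Ck K k (fun p => poly_momenta N a (q1 p, q2 p) (v1 p, v2 p)).
Proof.
  intros Ha H1 H2. unfold poly_momenta; simpl.
  apply (Ck_sum K k (fun i p => sum_f_R0 (fun j => a i j (q1 p, q2 p) * v1 p ^ i * v2 p ^ j) (N - i))).
  intros i.
  apply (Ck_sum K k (fun j p => a i j (q1 p, q2 p) * v1 p ^ i * v2 p ^ j)).
  intros j. repeat apply Ck_mult; auto using Ck_pow.
Qed.

Definition far_point_value (p : R * R) : R :=
  poly_momenta N a
    (fst p + -1 * r * d2 (foot gamma p), snd p + r * d1 (foot gamma p))
    (-1 * d1 (foot gamma p), -1 * d2 (foot gamma p)).

Lemma far_point_value_par t s : - rho < t < rho ->
  far_point_value (par gamma t s)
  = poly_momenta N a (par gamma (t + r) s) (- d1 s, - d2 s).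
Proof.
  intros Ht. destruct (signed_dist_par t s Ht) as [_ E]. unfold far_point_value.
  rewrite (E _ periodic_d1), (E _ periodic_d2), !par_coords; simpl.
  f_equal; f_equal; ring.
Qed.

Lemma far_point p :
  (fst p + -1 * r * d2 (foot gamma p), snd p + r * d1 (foot gamma p))
  = par gamma (signed_dist gamma p + r) (foot gamma p).
Proof.
  rewrite <- (par_foot p) at 1 3. rewrite !par_coords; simpl. f_equal; ring.
Qed.

(** Adding r to the signed distance sends the closed annulus into the domain of the coefficients and
    interior points to interior points, as composition requires. *)
Lemma Ck_far_point_value k : Ck (annulus gamma (- r) r) k far_point_value.
Proof.
  assert (HK : forall p, annulus gamma (- r) r p -> - rho < signed_dist gamma p < rho).
  { intros p Kp. apply annulus_iff in Kp; lra. }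
  assert (H1 : Ck (annulus gamma (- r) r) k (fun p => d1 (foot gamma p)))
    by (apply Ck_foot; auto using periodic_d1, smooth_d1).
  assert (H2 : Ck (annulus gamma (- r) r) k (fun p => d2 (foot gamma p)))
    by (apply Ck_foot; auto using periodic_d2, smooth_d2).
  apply (Ck_poly_momenta _ _ (fun p => fst p + -1 * r * d2 (foot gamma p))
    (fun p => snd p + r * d1 (foot gamma p)));
    try (apply Ck_mult; auto using Ck_const).
  intros i j. apply (Ck_comp _ (annulus gamma 0 (2 * r))).
  - apply Ck_of_smooth_up_to_boundary, integral.
  - apply Ck_plus; [apply Ck_fst | apply Ck_mult; auto using Ck_const].
  - apply Ck_plus; [apply Ck_snd | apply Ck_mult; auto using Ck_const].
  - intros p Kp. apply annulus_iff in Kp; try lra. rewrite far_point.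
    apply annulus_iff; try lra. destruct (signed_dist_par (signed_dist gamma p + r) (foot gamma p)); lra.
  - intros p Kp. apply interior_annulus_iff in Kp; try lra. rewrite far_point.
    apply interior_annulus_iff; try lra.
    destruct (signed_dist_par (signed_dist gamma p + r) (foot gamma p)); lra.
Qed.

(** The circle touches gamma from outside, and its far point is the point of tangency itself, so
    nothing has to be flowed. *)
Lemma F_outer_boundary s : F (par gamma (- r) s) = far_point_value (par gamma (- r) s).
Proof.
  rewrite far_point_value_par by lra. replace (- r + r) with 0 by ring. rewrite par_0.
  rewrite <- F_integral.
  - f_equal. rewrite par_coords. unfold vadd, vscal, Jrot; simpl.
    fold (g1 s) (g2 s). f_equal; ring.
  - unfold unit_vec, dot; simpl. pose proof (unit_tangent s). lra.
Qed.

Lemma F_half_open_annulus p : - r <= signed_dist gamma p < r -> F p = far_point_value p.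
Proof.
  intros H. rewrite <- (par_foot p). destruct (Req_dec (signed_dist gamma p) (- r)) as [E | E].
  - rewrite E. apply F_outer_boundary.
  - rewrite far_point_value_par by lra. apply F_open_annulus; lra.
Qed.

Lemma F_inner_boundary s : F (par gamma r s) = far_point_value (par gamma r s).
Proof.
  set (v := fun th => (cos th * d1 s - sin th * d2 s, sin th * d1 s + cos th * d2 s)).
  set (c := fun th => vadd (gamma s) (vscal r (Jrot (v th)))).
  assert (Hv : forall th, unit_vec (v th)).
  { intros th. unfold unit_vec, dot, v; simpl. pose proof (unit_tangent s) as U.
    pose proof (sin2_cos2 th) as SC. unfold Rsqr in SC.
    match goal with |- ?X = _ => replace X with
      ((sin th * sin th + cos th * cos th) * (d1 s * d1 s + d2 s * d2 s)) by ring end.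
    rewrite U, SC; ring. }
  assert (c0 : c 0 = par gamma r s).
  { rewrite par_coords. unfold c, v, vadd, vscal, Jrot; simpl. rewrite sin_0, cos_0.
    fold (g1 s) (g2 s). f_equal; ring. }
  assert (Ev : forall th, F (c th) = poly_momenta N a (gamma s) (v th))
    by (intros; apply F_integral, Hv).
  assert (Hc : continuous c 0).
  { apply (continuous_of_coords (fun th => fst (c th)) (fun th => snd (c th)));
      unfold c, v, vadd, vscal, Jrot; simpl; auto_derive; auto. }
  assert (Hvc : continuous v 0) by (apply continuous_of_coords; auto_derive; auto).
  assert (Hsmall : at_right 0 (fun th => 0 < th < PI)).
  { exists (mkposreal _ PI_RGT_0). intros th B T. change (Rabs (th - 0) < PI) in B.
    apply Rabs_def2 in B. lra. }
  (* Along this family the base point stays at [gamma s], so [F (c th)] is a polynomial in the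
     velocity; continuity of F is not presupposed. *)
  assert (L1 : filterlim (fun th => F (c th)) (at_right 0) (locally (F (c 0)))).
  { apply filterlim_ext with (fun th => poly_momenta N a (gamma s) (v th));
      [intros; symmetry; apply Ev |].
    rewrite Ev. eapply filterlim_filter_le_1; [apply filter_le_within |].
    apply (continuous_comp v (fun w => poly_momenta N a (gamma s) w)); auto.
    apply continuous_ext with
      (fun w => poly_momenta N a (fst (gamma s), snd (gamma s)) (fst w, snd w)).
    { intros [w1 w2]. rewrite <- surjective_pairing. reflexivity. }
    apply (continuous_on_interior (fun _ => True)); [| apply filter_true].
    apply (Ck_continuous _ 0), Ck_poly_momenta; auto using Ck_const, Ck_fst, Ck_snd. }
  (* For small positive [th] the velocity is strictly inward and the centre lies in the half-open
     annulus, where the formula is already known; the two limits then coincide. *)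
  assert (L2 : filterlim (fun th => F (c th)) (at_right 0) (locally (far_point_value (c 0)))).
  { assert (Kc : annulus gamma (- r) r (c 0)).
    { rewrite c0. exists s, r. split; [lra | reflexivity]. }
    intros P HP.
    assert (A : locally 0 (fun th => annulus gamma (- r) r (c th) -> P (far_point_value (c th))))
      by exact (Hc _ (Ck_continuous _ _ _ (Ck_far_point_value 0) _ Kc P HP)).
    assert (A' : at_right 0 (fun th => annulus gamma (- r) r (c th) -> P (far_point_value (c th))))
      by (revert A; apply filter_le_within).
    generalize (filter_and _ _ Hsmall A'). unfold filtermap. apply filter_imp.
    intros th [Hth HA]. pose proof (signed_dist_inward_center s th Hth) as Hsd.
    cbv zeta in Hsd. change (vadd _ _) with (c th) in Hsd.
    rewrite F_half_open_annulus by exact Hsd. apply HA. apply annulus_iff; lra. }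
  rewrite <- c0.
  exact (filterlim_locally_unique (K := R_AbsRing) (V := R_NormedModule) _ _ _ L1 L2).
Qed.

Lemma F_far_point_value p : annulus gamma (- r) r p -> F p = far_point_value p.
Proof.
  intros Kp. apply annulus_iff in Kp; try lra.
  destruct (Req_dec (signed_dist gamma p) r) as [E | E].
  - rewrite <- (par_foot p), E. apply F_inner_boundary.
  - apply F_half_open_annulus; lra.
Qed.

Lemma F_smooth : smooth_up_to_boundary (annulus gamma (- r) r) F.
Proof.
  apply smooth_up_to_boundary_of_Ck. intros k.
  apply Ck_ext with far_point_value; [| apply Ck_far_point_value].
  intros p Kp. symmetry. apply F_far_point_value, Kp.
Qed.

End Tube.

Theorem theorem2p3
  (gamma : R -> R * R) (L : R) (Omega : R * R -> Prop) (beta : R)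
  (N : nat) (a : nat -> nat -> R * R -> R) (F : R * R -> R) :
  simple_closed_arclength gamma L ->
  domain_bounded_by Omega gamma ->
  0 < beta ->
  curvature_assumption gamma L (/ beta) ->
  poly_integral Omega gamma (/ beta) N a ->
  (* F o L = Phi : F(x + r J v) = Phi(x, v) for x on gamma, v unit *)
  (forall s v, unit_vec v ->
     F (vadd (gamma s) (vscal (/ beta) (Jrot v))) = poly_momenta N a (gamma s) v) ->
  smooth_up_to_boundary (annulus gamma (- / beta) (/ beta)) F.
Proof.
  intros Hcurve Hdom Hbeta [rho [Hrho Htube]] Hint HF.
  apply (F_smooth gamma L Hcurve rho Htube Omega Hdom (/ beta)
    (Rinv_0_lt_compat _ Hbeta) Hrho N a Hint F HF).
Qed.
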